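(* Let $\sigma\in(0,1)$ be any fixed constant. Then for each $\lambda\in(0,\lambda_\sigma]$, the function $$u^{H_{\lambda,\sigma}}(t,x)=(1+t)^{-\lambda}H_{\lambda,\sigma}\!\left(\frac{x}{\sqrt{1+t}}\right)$$ is positive and is the solution of the $G$-heat equation $$\partial_tu-G(\partial_{xx}^2u)=0,\qquad (t,x)\in[0,+\infty)\times\mathbb{R},$$ with initial condition $u(0,x)=H_{\lambda,\sigma}(x)$.
   Context: For real $a$, $a^{+}=\max\{0,a\}$ and $a^{-}=(-a)^{+}$; $G(a)=\frac12(a^{+}-\sigma^{2}a^{-})$. Solutions of the $G$-heat equation are understood in the viscosity sense; since the equation is uniformly parabolic and $G$ is convex, for bounded Lipschitz initial data there is a unique bounded solution, and it is of class $C^{1,2}$ (known fact). For $\lambda\in(0,\frac12)$ and $x\in\mathbb{R}$, $$\varphi_\lambda(x):=\int_0^{+\infty}y^{-2\lambda}\exp\left\{-\frac{(y-x)^2}{2}\right\}dy ,$$ and primes denote derivatives in $x$. For each $\lambda\in(0,\frac12)$, $x_1^\lambda<0$ denotes the unique negative number with $\varphi_\lambda''(x_1^\lambda)=0$, $z^\lambda>0$ denotes the unique positive number with $\varphi_\lambda''(z^\lambda)+\varphi_\lambda''(-z^\lambda)=0$ (existence and uniqueness hold), and $\sigma_\lambda:=-x_1^\lambda/z^\lambda\in(0,1)$. The map $\lambda\mapsto\sigma_\lambda$ is a continuous strictly increasing bijection from $(0,\frac12)$ onto $(0,1)$; for $\sigma\in(0,1)$, $\lambda_\sigma\in(0,\frac12)$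 denotes the unique constant with $\sigma_{\lambda_\sigma}=\sigma$. For $\lambda\in(0,\frac12)$ and $\sigma\in[\sigma_\lambda,1)$ (equivalently $\lambda\le\lambda_\sigma$), define $$H_{\lambda,\sigma}(x):=\begin{cases}\mu_1^\lambda\varphi_\lambda(x)+\mu_2^\lambda\varphi_\lambda(-x), & x\le-\sigma z^\lambda,\\ \varphi_\lambda\!\left(\frac{x}{\sigma}\right)+\varphi_\lambda\!\left(-\frac{x}{\sigma}\right), & -\sigma z^\lambda<x<\sigma z^\lambda,\\ \mu_2^\lambda\varphi_\lambda(x)+\mu_1^\lambda\varphi_\lambda(-x), & x\ge\sigma z^\lambda,\end{cases}$$ where $$\mu_1^{\lambda}=\frac{\varphi_\lambda''(\sigma z^\lambda)\,[\varphi_\lambda(-z^\lambda)+\varphi_\lambda(z^\lambda)]}{\varphi_\lambda(-\sigma z^\lambda)\varphi_\lambda''(\sigma z^\lambda)-\varphi_\lambda(\sigma z^\lambda)\varphi_\lambda''(-\sigma z^\lambda)},\qquad \mu_2^{\lambda}=\frac{\varphi_\lambda''(-\sigma z^\lambda)\,[\varphi_\lambda(-z^\lambda)+\varphi_\lambda(z^\lambda)]}{\varphi_\lambda(\sigma z^\lambda)\varphi_\lambda''(-\sigma z^\lambda)-\varphi_\lambda(-\sigma z^\lambda)\varphi_\lambda''(\sigma z^\lambda)}.$$ *)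

(* Defs.v *)
From HB Require Import structures.
From mathcomp Require Import all_boot all_order all_algebra.
From mathcomp Require Import all_classical all_reals all_analysis.

Set Implicit Arguments.
Unset Strict Implicit.
Unset Printing Implicit Defensive.

Import Order.TTheory GRing.Theory Num.Theory.
Import numFieldNormedType.Exports.

Local Open Scope ring_scope.
Local Open Scope classical_set_scope.

Section GHeat.
Variable R : realType.
Implicit Types (sigma lam t x : R) (u psi : R -> R -> R).

Definition pos_part (a : R) : R := Num.max 0 a.
Definition neg_part (a : R) : R := pos_part (- a).

Definition G sigma (a : R) : R :=
  2^-1 * (pos_part a - sigma ^+ 2 * neg_part a).

(* Functions of (t, x) are curried, time first. *)
Definition d_t u t x : R := (fun s => u s x)^`()%classic t.
Definition d_x u t x : R := (u t)^`()%classic x.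
Definition d_xx u t x : R := (u t)^`(2)%classic x.

(* psi is of class C^{1,2} on ]0, +oo[ x R: the derivatives exist there and are
   jointly continuous. *)
Definition C12 psi : Prop :=
  forall t x, 0 < t ->
    [/\ derivable (fun s => psi s x) t 1,
        derivable (psi t) x 1,
        derivable (d_x psi t) x 1 &
        [/\ {for (t, x), continuous (fun p : R * R => psi p.1 p.2)},
            {for (t, x), continuous (fun p : R * R => d_t psi p.1 p.2)},
            {for (t, x), continuous (fun p : R * R => d_x psi p.1 p.2)} &
            {for (t, x), continuous (fun p : R * R => d_xx psi p.1 p.2)}]].

Definition viscosity_subsolution sigma u : Prop :=
  forall psi, C12 psi -> forall t x, 0 < t ->
    (\forall p \near (t, x), u p.1 p.2 - psi p.1 p.2 <= u t x - psi t x) ->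
    d_t psi t x - G sigma (d_xx psi t x) <= 0.

Definition viscosity_supersolution sigma u : Prop :=
  forall psi, C12 psi -> forall t x, 0 < t ->
    (\forall p \near (t, x), u t x - psi t x <= u p.1 p.2 - psi p.1 p.2) ->
    0 <= d_t psi t x - G sigma (d_xx psi t x).

(* Viscosity solution of the Cauchy problem on [0, +oo[ x R with datum f: the
   equation is tested at t > 0 and the datum is attained continuously at t = 0.
   The values of u at t < 0 are irrelevant. *)
Definition G_heat_solution sigma (f : R -> R) u : Prop :=
  [/\ {within [set p : R * R | 0 <= p.1],
         continuous (fun p : R * R => u p.1 p.2)},
      viscosity_subsolution sigma u,
      viscosity_supersolution sigma u &
      forall x, u 0 x = f x].

Definition bounded_for_nonneg_times u : Prop :=
  exists M : R, forall t x, 0 <= t -> `|u t x| <= M.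

Definition phi lam x : R :=
  \int[lebesgue_measure]_(y in `]0, +oo[)
    (y `^ (- (2 * lam)) * expR (- ((y - x) ^+ 2 / 2))).

Definition phi'' lam : R -> R := (phi lam)^`(2)%classic.

(* x1, z and lambda_ are definite descriptions: each set is a singleton for
   lam, sigma in the stated ranges; 0, which is in none of the three sets, is
   only a default outside of these ranges. *)
Definition x1 lam : R :=
  xget 0 [set x | x < 0 /\ phi'' lam x = 0].

Definition z lam : R :=
  xget 0 [set x | 0 < x /\ phi'' lam x + phi'' lam (- x) = 0].

Definition sigma_ lam : R := - x1 lam / z lam.

Definition lambda_ sigma : R :=
  xget 0 [set lam | 0 < lam < 2^-1 /\ sigma_ lam = sigma].

Definition mu1 lam sigma : R :=
  let a := sigma * z lam in
  phi'' lam a * (phi lam (- z lam) + phi lam (z lam)) /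
  (phi lam (- a) * phi'' lam a - phi lam a * phi'' lam (- a)).

Definition mu2 lam sigma : R :=
  let a := sigma * z lam in
  phi'' lam (- a) * (phi lam (- z lam) + phi lam (z lam)) /
  (phi lam a * phi'' lam (- a) - phi lam (- a) * phi'' lam a).

Definition H lam sigma x : R :=
  if x <= - (sigma * z lam) then
    mu1 lam sigma * phi lam x + mu2 lam sigma * phi lam (- x)
  else if x < sigma * z lam then
    phi lam (x / sigma) + phi lam (- (x / sigma))
  else
    mu2 lam sigma * phi lam x + mu1 lam sigma * phi lam (- x).

Definition uH lam sigma t x : R :=
  (1 + t) `^ (- lam) * H lam sigma (x / Num.sqrt (1 + t)).

End GHeat.

(* Main.v *)
(**
Write [f] for [phi_lambda] and [th x] for the integral of
[y^(1 - 2 lambda) exp (- (y - x)^2 / 2)]. Then [f' = th - x f] and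
[th' = (1 - 2 lambda) f], so [f'' + x f' + 2 lambda f = 0]. Multiplied by
[exp (x^2 / 2)], this equation and its derivatives become monotonicity
statements, which locate the zeros of [f''] and of [f''(x) + f''(- x)]; the
Wronskian of [f''(x)] and [f''(- x)] is a positive multiple of
[exp (- x^2 / 2)], so [f''(x) / f''(- x)] increases, which fixes the sign of
[H''] outside the glueing points.

The condition [sigma_lambda <= sigma] for [lambda <= lambda_sigma] comes from
two separate comparisons: [- x_1^lambda] increases with [lambda] because [th / f]
is the mean of [y] for a weight that moves towards [0], and [z^lambda] decreases
by a Sturm comparison of the even solutions [f x + f (- x)].

Hence [H] is of class C^2 and solves [G(H'') = - (x H' / 2 + lambda H)], so
[u^H] is a classical solution, and a viscosity one by the second derivative
test. For uniqueness [u^H +/- e (x^2 + 2 t)] serves as a test function: the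
penalty confines the maximum of the difference to a compact set, and no terminal
time is needed since it also grows in [t].
*)
Require Import Defs.
From mathcomp Require Import all_boot all_order all_algebra.
From mathcomp Require Import all_classical all_reals all_analysis.
From mathcomp Require Import measurable_realfun lebesgue_integral_under ring lra.

Set Implicit Arguments.
Unset Strict Implicit.
Unset Printing Implicit Defensive.

Import Order.TTheory GRing.Theory Num.Theory.
Import numFieldNormedType.Exports.

Local Open Scope ring_scope.
Local Open Scope classical_set_scope.

(** * Calculus on the real line *)

Section Calculus.
Variable R : realType.
Implicit Types (f g : R -> R) (x : R).

Lemma is_derive_fun_cst (c x : R) : is_derive x 1 (fun=> c : R) 0.
Proof. exact: is_derive_cst. Qed.

Lemma is_derive_fun_id x : is_derive x 1 (fun y : R => y) 1.
Proof. exact: is_derive_id. Qed.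

Lemma is_derive_funD f g x (a b : R) : is_derive x 1 f a -> is_derive x 1 g b ->
  is_derive x 1 (fun y => f y + g y) (a + b).
Proof. exact: is_deriveD. Qed.

Lemma is_derive_funN f x (a : R) : is_derive x 1 f a ->
  is_derive x 1 (fun y => - f y) (- a).
Proof. exact: is_deriveN. Qed.

Lemma is_derive_funM f g x (a b : R) : is_derive x 1 f a -> is_derive x 1 g b ->
  is_derive x 1 (fun y => f y * g y) (f x * b + g x * a).
Proof. exact: is_deriveM. Qed.

Lemma is_derive_fun_sqr f x (a : R) : is_derive x 1 f a ->
  is_derive x 1 (fun y => f y ^+ 2) (2 * f x * a).
Proof.
move=> fa; under eq_fun do rewrite expr2.
by rewrite mulrDl mul1r mulrDl; exact: is_derive_funM.
Qed.

Lemma is_derive_fun_comp f g x (a b : R) :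
  is_derive (g x) 1 f a -> is_derive x 1 g b ->
  is_derive x 1 (fun y => f (g y)) (a * b).
Proof. exact: is_derive1_comp. Qed.

Lemma is_derive_funV f x (a : R) : f x != 0 -> is_derive x 1 f a ->
  is_derive x 1 (fun y => (f y)^-1) (- a / f x ^+ 2).
Proof.
move=> fx0 fa; have /is_derive_eq := is_deriveV fx0 fa; apply.
by rewrite /GRing.scale/= !mulNr mulrC.
Qed.

Lemma is_derive_fun_expR f x (a : R) : is_derive x 1 f a ->
  is_derive x 1 (fun y => expR (f y)) (expR (f x) * a).
Proof. by move=> fa; apply: is_derive_fun_comp. Qed.

Lemma is_derive_continuous f x (a : R) : is_derive x 1 f a ->
  {for x, continuous f}.
Proof. by move=> [df _]; apply: differentiable_continuous; exact/derivable1_diffP. Qed.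

Lemma is_derive_derive1 f x (a : R) : is_derive x 1 f a -> f^`()%classic x = a.
Proof. by move=> [_ da]; rewrite derive1E. Qed.

Lemma mean_value f (df : R -> R) (a b : R) : a < b ->
  (forall x, a <= x <= b -> is_derive x 1 f (df x)) ->
  exists2 c, a < c < b & f b - f a = df c * (b - a).
Proof.
move=> ab fdf; have [x||c] := @MVT R f df a b ab.
- by rewrite in_itv/= => /andP[/ltW ax /ltW xb]; apply: fdf; rewrite ax.
- apply: derivable_within_continuous => x; rewrite in_itv/= => xab.
  by have [] := fdf x xab.
- by rewrite in_itv => cab ->; exists c.
Qed.

Lemma ler_is_derive f (df : R -> R) (a b : R) : a <= b ->
  (forall x, a <= x <= b -> is_derive x 1 f (df x)) ->
  (forall x, a < x < b -> 0 <= df x) -> f a <= f b.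
Proof.
rewrite le_eqVlt => /predU1P[->//|ab] fdf df0.
have [c cab e] := mean_value ab fdf.
by rewrite -subr_ge0 e mulr_ge0 ?df0// subr_ge0 ltW.
Qed.

Lemma ltr_is_derive f (df : R -> R) (a b : R) : a < b ->
  (forall x, a <= x <= b -> is_derive x 1 f (df x)) ->
  (forall x, a < x < b -> 0 < df x) -> f a < f b.
Proof.
move=> ab fdf df0; have [c cab e] := mean_value ab fdf.
by rewrite -subr_gt0 e mulr_gt0 ?subr_gt0 ?df0.
Qed.

End Calculus.

Lemma is_derive_subst (R : realType) (f : R -> R) (x a b : R) :
  is_derive x 1 f a -> a = b -> is_derive x 1 f b.
Proof. by move=> fa <-. Qed.

(* Plain [refine] would let type class inference guess other instances for
   [is_derive], leaving derivatives in a form [ring] does not see through. *)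
Ltac derive_step :=
  first [ notypeclasses refine (is_derive_fun_cst _ _)
   | notypeclasses refine (is_derive_fun_id _)
   | match goal with H : _ |- _ => solve [simple apply H] end
   | match goal with H : forall y, is_derive y _ _ _ |- _ =>
       notypeclasses refine (is_derive_fun_comp (H _) _) end
   | notypeclasses refine (is_derive_fun_sqr _)
   | notypeclasses refine (is_derive_funD _ _)
   | notypeclasses refine (is_derive_funN _)
   | notypeclasses refine (is_derive_funM _ _)
   | notypeclasses refine (is_derive_fun_expR _) ].
Ltac derive := try (move=> _);
  notypeclasses refine (is_derive_subst _ _); [repeat derive_step|rewrite /=].

(** * The equation [f'' + x f' + 2 l f = 0] *)

Section Profile.
Variable R : realType.
Implicit Types (f th : R -> R) (l x y : R).

(** Abstracts [phi] and its next moment: the signs of the derivatives and the glueing are derived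
    from these relations alone, without the integral. *)
Definition is_profile l f th : Prop :=
  [/\ 0 < l < 2^-1, forall x, 0 < f x, forall x, 0 < th x,
      forall x, is_derive x 1 f (th x - x * f x) &
      forall x, is_derive x 1 th ((1 - 2 * l) * f x)].

(* [prof1], [prof2], [prof3] are the first three derivatives of a profile [f]. *)
Definition prof1 f th x : R := th x - x * f x.
Definition prof2 l f th x : R := - x * prof1 f th x - 2 * l * f x.
Definition prof3 l f th x : R := - x * prof2 l f th x - (1 + 2 * l) * prof1 f th x.
Definition gauss x : R := expR (x ^+ 2 / 2).

Lemma gauss_gt0 x : 0 < gauss x. Proof. exact: expR_gt0. Qed.

Lemma is_derive_gauss x : is_derive x 1 gauss (x * gauss x).
Proof. by rewrite /gauss; derive; field. Qed.

Section OneProfile.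
Variables (l : R) (f th : R -> R).
Hypothesis P : is_profile l f th.
Local Notation f1 := (prof1 f th).
Local Notation f2 := (prof2 l f th).
Local Notation f3 := (prof3 l f th).

Let l_gt0 : 0 < l. Proof. by case: P => /andP[]. Qed.
Let f_gt0 x : 0 < f x. Proof. by case: P. Qed.
Let th_gt0 x : 0 < th x. Proof. by case: P. Qed.

Lemma is_derive_prof x : is_derive x 1 f (f1 x).
Proof. by case: P. Qed.

Lemma is_derive_prof1 x : is_derive x 1 f1 (f2 x).
Proof.
case: P => _ _ _ df dth; rewrite /prof1; derive.
by rewrite /prof2 /prof1; ring.
Qed.

Lemma is_derive_prof2 x : is_derive x 1 f2 (f3 x).
Proof.
have df := is_derive_prof; have df1 := is_derive_prof1.
by rewrite /prof2; derive; rewrite /prof3 /prof2; ring.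
Qed.

Lemma is_derive_prof3 x : is_derive x 1 f3 (- x * f3 x - (2 + 2 * l) * f2 x).
Proof.
have df1 := is_derive_prof1; have df2 := is_derive_prof2.
by rewrite /prof3; derive; rewrite /prof3; ring.
Qed.

Lemma prof1_gt0 x : x <= 0 -> 0 < f1 x.
Proof.
move=> x0; rewrite subr_gt0 (le_lt_trans _ (th_gt0 x))//.
by rewrite mulr_le0_ge0// ltW.
Qed.

Lemma prof2_0_lt0 : f2 0 < 0.
Proof. by rewrite /prof2 oppr0 mul0r sub0r oppr_lt0 !mulr_gt0. Qed.

Let dg := is_derive_gauss.

(* The integrating factor [exp (x^2 / 2)] turns each of the three equations
   into a monotonicity statement. *)
Lemma gauss_prof1_decr x y : x < y -> gauss y * f1 y < gauss x * f1 x.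
Proof.
move=> xy; rewrite -ltrN2.
apply: (@ltr_is_derive _ (fun t => - (gauss t * f1 t))
  (fun t => gauss t * (2 * l * f t))) => [//|t _|t _].
  have df1 := is_derive_prof1; derive.
  by rewrite /prof2; ring.
by rewrite !mulr_gt0 ?gauss_gt0.
Qed.

(** The derivative of [gauss * f2] is [- (1 + 2 l) gauss * f1], and [prof1_gt0] gives the sign of
    [f1] on the left half-line. *)
Lemma gauss_prof2_decr x y : x < y -> y <= 0 ->
  gauss y * f2 y < gauss x * f2 x.
Proof.
move=> xy y0; rewrite -ltrN2.
apply: (@ltr_is_derive _ (fun t => - (gauss t * f2 t))
  (fun t => gauss t * ((1 + 2 * l) * f1 t))) => [//|t|t].
  have df2 := is_derive_prof2; derive.
  by rewrite /prof3; ring.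
move=> /andP[_ ty]; have l1 : 0 < 1 + 2 * l by have := l_gt0; lra.
by rewrite !mulr_gt0 ?gauss_gt0// prof1_gt0// ltW// (lt_le_trans ty).
Qed.

Lemma prof2_neg_gt0 a x : 0 <= a -> 0 <= f2 (- a) -> a < x -> 0 < f2 (- x).
Proof.
move=> a0 fa ax; rewrite -(pmulr_rgt0 _ (gauss_gt0 (- x))).
apply: (le_lt_trans _ (@gauss_prof2_decr (- x) (- a) _ _)); last 2 first.
- by rewrite ltrN2.
- by rewrite oppr_le0.
- by rewrite mulr_ge0// ltW// gauss_gt0.
Qed.

(** If [f1 y >= 0], the formula for [f2 y] shows its sign. Otherwise [f1] stays negative to the
    right of [y], so [gauss * f2] increases on [[y, x]] and is negative at [y] as it is at [x]. *)
Lemma prof2_pos_lt0 y x : 0 <= y -> y <= x -> f2 x < 0 -> f2 y < 0.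
Proof.
move=> y0 yx fx; have [f1y|f1y] := leP 0 (f1 y).
  have lf : 0 < l * f y by exact: mulr_gt0.
  have : 0 <= y * f1 y by exact: mulr_ge0.
  by rewrite /prof2; lra.
rewrite -(pmulr_rlt0 _ (gauss_gt0 y)).
apply: (@le_lt_trans _ _ (gauss x * f2 x)); last by rewrite pmulr_rlt0 ?gauss_gt0.
apply: (@ler_is_derive _ (fun t => gauss t * f2 t)
  (fun t => gauss t * (- (1 + 2 * l) * f1 t))) => [//|t|t].
  have df2 := is_derive_prof2; derive.
  by rewrite /prof3; ring.
move=> /andP[yt _]; have := gauss_prof1_decr yt; have := gauss_gt0 t.
have := gauss_gt0 y => gy gt h.
have : gauss t * f1 t < 0 by rewrite (lt_trans h)// pmulr_rlt0.
by rewrite pmulr_rlt0// => f1t; rewrite mulr_ge0 ?ltW// nmulr_rgt0//; have := l_gt0; lra.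
Qed.

(** Were [f] concave on the whole left half-line, it would lie below its tangent at [0], whose slope
    is positive, and could not stay positive. The intermediate value theorem concludes, as
    [f2 0 < 0]. *)
Lemma prof_neg_inflection : exists2 x, x < 0 & f2 x = 0.
Proof.
have f10 : 0 < f1 0 by exact: prof1_gt0.
have [x x0 f2x] : exists2 x, x < 0 & 0 <= f2 x.
  apply: contrapT => /forall2NP no.
  have f2N x : x < 0 -> f2 x < 0.
    by move=> x0; rewrite ltNge; apply/negP => f2x; case: (no x).
  have f1_ge x : x <= 0 -> f1 0 <= f1 x.
    move=> x0; rewrite -lerN2.
    apply: (@ler_is_derive _ (fun t => - f1 t) (fun t => - f2 t)) => [//|t|t].
      by have df1 := is_derive_prof1; derive.
    by move=> /andP[_ /f2N]; lra.
  (* The zero of the tangent at [0]. *)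
  pose x := - (f 0 / f1 0).
  have x0 : x <= 0 by rewrite oppr_le0 divr_ge0// ltW.
  have : f x - f1 0 * x <= f 0 - f1 0 * 0.
    apply: (@ler_is_derive _ (fun t => f t - f1 0 * t) (fun t => f1 t - f1 0)) => [//|t|t].
      by have df := is_derive_prof; derive; ring.
    by move=> /andP[_ /ltW/f1_ge]; lra.
  have -> : f1 0 * x = - f 0 by rewrite /x; field; rewrite gt_eqF.
  by have := f_gt0 x; lra.
have [||c cx0 f2c] := @IVT R f2 x 0 0 (ltW x0).
- apply: derivable_within_continuous => t _.
  by have [] := is_derive_prof2 t.
- have := prof2_0_lt0 => /ltW f20.
  by rewrite ge_min le_max f20 f2x orbT.
exists c => //; move: cx0; rewrite in_itv/= => /andP[_].
rewrite le_eqVlt => /predU1P[c0|//].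
by move: f2c prof2_0_lt0; rewrite c0 => ->; rewrite ltxx.
Qed.

Definition even0 x := f x + f (- x).
Definition even1 x := f1 x - f1 (- x).
Definition even2 x := f2 x + f2 (- x).

Lemma is_derive_even0 x : is_derive x 1 even0 (even1 x).
Proof. by have df := is_derive_prof; rewrite /even0; derive; rewrite /even1; ring. Qed.

Lemma is_derive_even1 x : is_derive x 1 even1 (even2 x).
Proof. by have df := is_derive_prof1; rewrite /even1; derive; rewrite /even2; ring. Qed.

Lemma even2E x : even2 x = - x * even1 x - 2 * l * even0 x.
Proof. by rewrite /even2 /even1 /even0 /prof2; ring. Qed.

Lemma even0_gt0 x : 0 < even0 x. Proof. exact: addr_gt0. Qed.

(** The product [gauss * even1] vanishes at [0] and has derivative [- 2 l gauss * even0 < 0]. *)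
Lemma even1_lt0 x : 0 < x -> even1 x < 0.
Proof.
move=> x0; rewrite -(pmulr_rlt0 _ (gauss_gt0 x)) -oppr_gt0.
have -> : 0 = - (gauss 0 * even1 0) by rewrite /even1 oppr0 subrr mulr0 oppr0.
apply: (@ltr_is_derive _ (fun t => - (gauss t * even1 t))
  (fun t => gauss t * (2 * l * even0 t))) => [//|t _|t _].
  have df2 := is_derive_even1; derive.
  by rewrite even2E; ring.
by rewrite !mulr_gt0 ?gauss_gt0 ?even0_gt0.
Qed.

(** The concavity argument of [prof_neg_inflection], on the right half-line. The tangent is taken at
    [1], because the slope at [0] is zero. *)
Lemma even_inflection : exists2 x, 0 < x & even2 x = 0.
Proof.
have e20 : even2 0 < 0 by have := prof2_0_lt0; rewrite /even2 oppr0; lra.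
have [x x0 e2x] : exists2 x, 0 < x & 0 <= even2 x.
  apply: contrapT => /forall2NP no.
  have e2N x : 0 < x -> even2 x < 0.
    by move=> x0; rewrite ltNge; apply/negP => f2x; case: (no x).
  have e1_ge x : 1 <= x -> even1 x <= even1 1.
    move=> x0; rewrite -lerN2.
    apply: (@ler_is_derive _ (fun t => - even1 t) (fun t => - even2 t)) => [//|t|t].
      by have df1 := is_derive_even1; derive.
    by move=> /andP[t1 _]; have := e2N t (lt_trans ltr01 t1); lra.
  have e11 : even1 1 < 0 by exact: even1_lt0.
  pose x := 1 - even0 1 / even1 1.
  have x1 : 1 <= x.
    by rewrite /x lerDl oppr_ge0 nmulr_lle0 ?invr_lt0// ltW// even0_gt0.
  have : - (even0 1 - even1 1 * 1) <= - (even0 x - even1 1 * x).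
    apply: (@ler_is_derive _ (fun t => - (even0 t - even1 1 * t))
      (fun t => even1 1 - even1 t)) => [//|t|t].
      by have df := is_derive_even0; derive; ring.
    by move=> /andP[/ltW/e1_ge + _]; lra.
  have -> : even1 1 * x = even1 1 - even0 1 by rewrite /x; field; rewrite lt_eqF.
  by have := even0_gt0 x; lra.
have [||c cx0 f2c] := @IVT R even2 0 x 0 (ltW x0).
- apply: derivable_within_continuous => t _.
  have df := is_derive_prof2.
  suff : is_derive t 1 even2 (f3 t - f3 (- t)) by case.
  by rewrite /even2; derive; ring.
- by rewrite ge_min le_max e2x orbT (ltW e20).
exists c => //; move: cx0; rewrite in_itv/= => /andP[+ _].
rewrite le_eqVlt => /predU1P[c0|//].
by move: f2c e20; rewrite -c0 => ->; rewrite ltxx.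
Qed.

(** Both [f2] and its reflection solve [g'' + x g' + (2 + 2 l) g = 0], so by Abel's identity [gauss]
    times the Wronskian is constant. Its value at [0] is [2 f2 0 f3 0], a product of two negative
    factors up to the [2]. *)
Lemma wronskian_gt0 x : 0 < f3 x * f2 (- x) + f2 x * f3 (- x).
Proof.
rewrite -(pmulr_rgt0 _ (gauss_gt0 x)).
have df2 := is_derive_prof2; have df3 := is_derive_prof3.
pose W t := gauss t * (f3 t * f2 (- t) + f2 t * f3 (- t)).
have dW (t : R) : is_derive t 1 W 0 by rewrite /W; derive; ring.
rewrite -/(W x) (is_derive_0_is_cst x 0 dW) /W oppr0 mulr_gt0 ?gauss_gt0//.
have := prof2_0_lt0; have := prof1_gt0 (lexx 0).
have : f3 0 = - (1 + 2 * l) * f1 0 by rewrite /prof3; ring.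
move=> -> h h'; apply: addr_gt0; [rewrite nmulr_rgt0//|rewrite nmulr_lgt0//].
  all: by have := l_gt0; nra.
Qed.

Lemma prof2_ratio_incr x y : x < y ->
  (forall t, x <= t <= y -> 0 < f2 (- t)) ->
  f2 x / f2 (- x) < f2 y / f2 (- y).
Proof.
move=> xy f2N; apply: (@ltr_is_derive _ (fun t => f2 t / f2 (- t))
  (fun t => (f3 t * f2 (- t) + f2 t * f3 (- t)) / f2 (- t) ^+ 2)) => // t txy.
  have df := is_derive_prof2.
  have df' : is_derive t 1 (fun s => (f2 (- s))^-1) (- (- f3 (- t)) / f2 (- t) ^+ 2).
    apply: is_derive_funV; first by rewrite gt_eqF// f2N.
    by derive; ring.
  by derive; field; rewrite gt_eqF// f2N.
have /andP[/ltW xt /ltW ty] := txy.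
by rewrite divr_gt0 ?wronskian_gt0// exprn_gt0// f2N ?xt.
Qed.

(** * Signs of [f2] and [even2] when [- a] is at or to the left of the negative inflection point *)

Section Inflections.
Variables a z : R.
Hypotheses (a_ge0 : 0 <= a) (f2a : 0 <= f2 (- a)) (az : a < z) (e2z : even2 z = 0).

Let f2Nz : 0 < f2 (- z). Proof. exact: prof2_neg_gt0 az. Qed.

Lemma prof2_lt0 x : 0 <= x <= z -> f2 x < 0.
Proof.
move=> /andP[x0 xz]; apply: prof2_pos_lt0 xz _ => //.
by move: e2z f2Nz; rewrite /even2; lra.
Qed.

(** The ratio [f2 x / f2 (- x)] increases and equals [-1] at [z], so it is below [-1] before [z]
    wherever [f2 (- x) > 0]; elsewhere [f2 x < 0] suffices. *)
Lemma even2_lt0 x : 0 <= x < z -> even2 x < 0.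
Proof.
move=> /andP[x0 xz]; have f2x : f2 x < 0 by rewrite prof2_lt0// x0 ltW.
rewrite /even2; have [?|f2Nx] := leP (f2 (- x)) 0; first by lra.
have := @prof2_ratio_incr x z xz.
have -> : f2 z / f2 (- z) = -1.
  have -> : f2 z = - f2 (- z) by move: e2z; rewrite /even2; lra.
  by rewrite mulNr divff// gt_eqF.
rewrite ltr_pdivrMr// mulN1r => h; rewrite -ltrBrDr sub0r; apply: h => t /andP[].
rewrite le_eqVlt => /predU1P[<-//|xt _].
by apply: prof2_neg_gt0 xt => //; exact: ltW.
Qed.

(** Monotonicity of the same ratio between [a] and [x], with denominators cleared. The case
    [f2 (- a) = 0], where the ratio at [a] is meaningless, follows from [f2 a < 0]. *)
Lemma prof2_cross_ge0 x : a <= x -> 0 <= f2 (- a) * f2 x - f2 a * f2 (- x).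
Proof.
rewrite le_eqVlt => /predU1P[<-|ax]; first by rewrite mulrC subrr.
have f2x := prof2_neg_gt0 a_ge0 f2a ax.
have f2a' : f2 a < 0 by rewrite prof2_lt0// a_ge0 ltW.
move: f2a; rewrite le_eqVlt => /predU1P[<-|f2a0]; first by nra.
rewrite subr_ge0; have := @prof2_ratio_incr a x ax.
rewrite ltr_pdivrMr// mulrAC ltr_pdivlMr// => h.
rewrite [leRHS]mulrC ltW// h// => t /andP[].
rewrite le_eqVlt => /predU1P[<-//|xt _].
exact: prof2_neg_gt0 xt.
Qed.

End Inflections.

(** For [x <= 0], [f] increases. For [x > 0], the energy [e] decreases, its derivative being
    [- 2 x f1 ^+ 2], and it controls [f ^+ 2]. *)
Lemma prof_bounded : exists M, forall x, f x <= M.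
Proof.
pose e x := f1 x ^+ 2 + 2 * l * f x ^+ 2.
(* The term [1 + E] serves as a bound for the square root of [E = e 0 / (2 l)]. *)
exists (f 0 + (1 + e 0 / (2 * l))) => x.
have df := is_derive_prof; have df1 := is_derive_prof1.
have e0 : 0 <= e 0 / (2 * l).
  have l0 : 0 <= 2 * l by rewrite mulr_ge0// ltW.
  by rewrite divr_ge0// /e addr_ge0 ?sqr_ge0// mulr_ge0// sqr_ge0.
have [x0|x0] := leP x 0.
  have : f x <= f 0.
    by apply: (@ler_is_derive _ f f1) => // t /andP[_ /ltW]; move/prof1_gt0/ltW.
  by lra.
have ex : - e 0 <= - e x.
  apply: (@ler_is_derive _ (fun t => - e t) (fun t => 2 * t * f1 t ^+ 2)).
  - exact: ltW.
  - by move=> t _; rewrite /e; derive; rewrite /prof2; ring.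
  - by move=> t /andP[/ltW t0 _]; rewrite mulr_ge0 ?sqr_ge0// mulr_ge0.
have : f x ^+ 2 <= e 0 / (2 * l).
  rewrite ler_pdivlMr ?mulr_gt0//; move: ex; rewrite {2}/e.
  by have := sqr_ge0 (f1 x); lra.
by have := f_gt0 0; have := f_gt0 x; nra.
Qed.

End OneProfile.

(** * Comparison of the inflection points for two parameters *)

Section Comparison.
Variables (l l' : R) (f th f' th' : R -> R).
Hypotheses (P : is_profile l f th) (P' : is_profile l' f' th') (ll' : l <= l').

(** Sturm comparison: with the weights [1 / l] and [1 / l'] the zero-order terms cancel in the
    derivative of the Wronskian, which leaves the product of the two negative slopes times
    [1 / l - 1 / l' >= 0]. At a zero of the first [even2], this Wronskian is a positive multiple of
    the second. *)
Lemma even_inflection_mono z : 0 < z ->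
  even2 l f th z = 0 -> 0 <= even2 l' f' th' z.
Proof.
move=> z0 e2z; have l0 : 0 < l by case: P => /andP[].
have l'0 : 0 < l' by case: P' => /andP[].
have K : gauss 0 * (even1 f th 0 * even0 f' 0 / l - even1 f' th' 0 * even0 f 0 / l')
    <= gauss z * (even1 f th z * even0 f' z / l - even1 f' th' z * even0 f z / l').
  apply: (@ler_is_derive _ (fun t => gauss t *
    (even1 f th t * even0 f' t / l - even1 f' th' t * even0 f t / l'))
    (fun t => gauss t * (even1 f th t * even1 f' th' t * (l^-1 - l'^-1)))).
  - exact: ltW.
  - move=> t _; have dg := is_derive_gauss.
    have d0 := is_derive_even0 P; have d1 := is_derive_even1 P.
    have d0' := is_derive_even0 P'; have d1' := is_derive_even1 P'.
    derive; rewrite !even2E; field.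
    by rewrite !gt_eqF.
  - move=> t /andP[t0 _]; rewrite mulr_ge0 ?(ltW (gauss_gt0 _))//.
    rewrite mulr_ge0//; last by rewrite subr_ge0 lef_pV2.
    by rewrite nmulr_rge0 ?(even1_lt0 P)// ltW// (even1_lt0 P').
move: K; rewrite {1 2}/even1 !oppr0 !subrr !mul0r subrr mulr0.
rewrite pmulr_rge0 ?gauss_gt0// => K.
move: e2z; rewrite !even2E.
have h0 := even0_gt0 P z; set h := even0 f z in h0 K *.
set h1 := even1 f th z in K *; set k1 := even1 f' th' z in K *.
set k := even0 f' z in K * => e.
have h1E : h1 = - (2 * l * h / z).
  apply: (mulfI (lt0r_neq0 z0)); rewrite mulrN mulrCA divff ?gt_eqF// mulr1; lra.
move: K; have -> : h1 * k / l - k1 * h / l' = - (h / (z * l')) * (z * k1 + 2 * l' * k).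
  by rewrite h1E; field; rewrite !gt_eqF.
rewrite nmulr_rge0 ?oppr_lt0 ?divr_gt0 ?mulr_gt0//; lra.
Qed.

(** At [- y] the quotient [f2 / f] equals [y th / f + y ^+ 2 - 2 l], which decreases when [th / f]
    decreases and [l] increases. *)
Lemma prof_inflection_mono y : 0 < y ->
  th' (- y) * f (- y) <= th (- y) * f' (- y) ->
  prof2 l f th (- y) = 0 -> prof2 l' f' th' (- y) <= 0.
Proof.
move=> y0 th_le f2y; have fy : 0 < f (- y) by case: P.
have f'y : 0 < f' (- y) by case: P'.
rewrite -(pmulr_lle0 _ fy); move: f2y th_le; rewrite /prof2 /prof1.
move: (f (- y)) (f' (- y)) (th (- y)) (th' (- y)) fy f'y => F F' T T' F0 F'0 e le_T.
have le1 : y * (T' * F) <= y * (T * F') by rewrite ler_pM2l.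
have le2 : l * (F * F') <= l' * (F * F') by rewrite ler_pM2r// mulr_gt0.
have : y * T * F' + y * y * F * F' - 2 * l * F * F' = 0.
  by rewrite -[RHS](mul0r F') -e; ring.
by lra.
Qed.

(* The negative inflection point of [f] and the even one of [f + f (- _)] both
   move monotonically in [l], in opposite directions. *)
Lemma prof2_opp_scale_ge0 sigma x z x' z' : 0 < sigma < 1 ->
  th' x * f x <= th x * f' x ->
  x < 0 -> prof2 l f th x = 0 -> 0 < z -> even2 l f th z = 0 ->
  x' < 0 -> prof2 l' f' th' x' = 0 -> 0 < z' -> even2 l' f' th' z' = 0 ->
  - x' = sigma * z' -> 0 <= prof2 l f th (- (sigma * z)).
Proof.
move=> /andP[s0 s1] th_le x0 fx z0 fz x'0 fx' z'0 fz' x'E.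
have y0 : 0 < - x by rewrite oppr_gt0.
have y'0 : 0 <= - x' by rewrite oppr_ge0 ltW.
have fy' : 0 <= prof2 l' f' th' (- - x') by rewrite opprK fx'.
(* Otherwise [x] would be to the left of [x'], where the second derivative for [l'] is positive. *)
have xx : - x <= - x'.
  rewrite leNgt; apply/negP => /(prof2_neg_gt0 P' y'0 fy'); apply/negP.
  by rewrite -leNgt prof_inflection_mono ?opprK.
(* Otherwise [even2] for [l'] would be negative at [z], by [even2_lt0] with [a = - x']. *)
have zz : z' <= z.
  rewrite leNgt; apply/negP => z_lt.
  have := even_inflection_mono z0 fz; apply/negP; rewrite -ltNge.
  apply: (even2_lt0 P' y'0 fy' _ fz'); last by rewrite (ltW z0).
  by rewrite x'E gtr_pMl.
have : - x <= sigma * z by rewrite (le_trans xx)// x'E ler_pM2l.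
rewrite le_eqVlt => /predU1P[<-|xs]; first by rewrite opprK fx.
by apply/ltW/(prof2_neg_gt0 P _ _ xs); rewrite ?opprK ?fx// ltW.
Qed.

End Comparison.

End Profile.

(** * The profile [phi] and its moments *)

Section ImproperIntegral.
Variable R : realType.
Implicit Types (f g F : R -> R) (n : nat).
Local Notation mu := (@lebesgue_measure R).
Local Notation D := (`]0, +oo[%classic : set R).
(** Compact exhaustion away from the possible singularity at [0]; [n.+2] keeps the endpoints
    distinct for [n = 0]. *)
Local Notation A n := (`[n.+2%:R^-1, n.+2%:R]%classic : set R).

Lemma itvoyE : D = \bigcup_n A n.
Proof.
apply/seteqP; split => [x|x [n _]] /=; rewrite !in_itv/= andbT; last first.
  by move=> /andP[+ _]; apply: lt_le_trans; rewrite invr_gt0.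
move=> x0; pose n := Num.trunc (Num.max x x^-1).
have xn : Num.max x x^-1 < n.+2%:R.
  rewrite (lt_trans (truncnS_gt _))// ltr_nat.
  by [].
exists n => //=; rewrite in_itv/=; move: xn; rewrite gt_max => /andP[xn xVn].
by rewrite (ltW xn) andbT -[leRHS]invrK lef_pV2 ?posrE ?invr_gt0// ltW.
Qed.

Lemma subset_itvoy n : A n `<=` D.
Proof. by rewrite itvoyE => x Anx; exists n. Qed.

Lemma measurable_itvoy f : {in D, continuous f} -> measurable_fun D (EFin \o f).
Proof.
move=> cf; apply/measurable_EFinP; exact: open_continuous_measurable_fun.
Qed.

Lemma cvg_integral_itvoy (f : R -> \bar R) : measurable_fun D f ->
  (forall x, D x -> (0 <= f x)%E) ->
  (\int[mu]_(x in A n) f x)%E @[n --> \oo] --> (\int[mu]_(x in D) f x)%E.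
Proof.
move=> mf f0; rewrite itvoyE; apply: ge0_nondecreasing_set_cvg_integral => //.
- move=> m n mn; apply/subsetPset => x /=; rewrite !in_itv/= => /andP[xm mx].
  rewrite (le_trans _ xm) ?(le_trans mx)//; first by rewrite ler_nat.
  by rewrite lef_pV2 ?posrE// ler_nat.
- by move=> n; apply: (measurable_funS _ (@subset_itvoy n) mf).
- by move=> n x /subset_itvoy/f0.
Qed.

Lemma integral_itvoy_FTC f F n : {in D, continuous f} ->
  (forall x : R, 0 < x -> is_derive x 1 F (f x)) ->
  (\int[mu]_(x in A n) (f x)%:E = (F n.+2%:R - F n.+2%:R^-1)%:E)%E.
Proof.
move=> cf dF; have lt_n : (n.+2%:R^-1 : R) < n.+2%:R.
  by apply: (@lt_trans _ _ 1); rewrite ?invf_lt1 ?ltr1n.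
have n0 : 0 < (n.+2%:R^-1 : R) by rewrite invr_gt0.
have cF (x : R) : 0 < x -> F y @[y --> x] --> F x.
  by move=> x0; apply: is_derive_continuous (dF x x0).
rewrite (@continuous_FTC2 _ _ F)//.
- apply: continuous_in_subspaceT => x /set_mem/subset_itvoy xD.
  by apply: cf; exact/mem_set.
- split.
  + move=> x; rewrite in_itv/= => /andP[xn _].
    by have [] := dF x (lt_trans n0 xn).
  + by apply: cvg_at_right_filter; exact: cF.
  + by apply: cvg_at_left_filter; apply: cF; exact: lt_trans lt_n.
- move=> x; rewrite in_itv/= => /andP[xn _].
  exact: is_derive_derive1 (dF x (lt_trans n0 xn)).
Qed.

(** The integrals over [A n] are increments of [F], hence at most [2 M]; monotone convergence does
    the rest. *)
Lemma integrable_itvoy_FTC f F (M : R) : {in D, continuous f} ->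
  (forall x : R, 0 < x -> 0 <= f x) ->
  (forall x : R, 0 < x -> is_derive x 1 F (f x)) ->
  (forall x : R, 0 < x -> `|F x| <= M) ->
  mu.-integrable D (EFin \o f).
Proof.
move=> cf f0 dF FM; have mf := measurable_itvoy cf.
apply/integrableP; split => //.
under eq_integral => x /set_mem.
  rewrite /= in_itv/= andbT => x0; rewrite ger0_norm ?f0//; over.
have f0' x : D x -> (0 <= (EFin \o f) x)%E.
  by rewrite /= in_itv/= andbT lee_fin => /f0.
have le2M n : (\int[mu]_(x in A n) (EFin \o f) x <= (2 * M)%:E)%E.
  rewrite (integral_itvoy_FTC n cf dF) lee_fin.
  have n0 : 0 < (n.+2%:R^-1 : R) by rewrite invr_gt0.
  have := FM n.+2%:R (ltr0Sn _ _); have := FM _ n0.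
  by rewrite !ler_norml => /andP[? ?] /andP[? ?]; lra.
apply: (@le_lt_trans _ _ (2 * M)%:E); last by rewrite ltry.
rewrite -(cvg_lim _ (cvg_integral_itvoy mf f0'))//.
apply: lime_le; last by apply: nearW.
by apply: cvgP; exact: (cvg_integral_itvoy mf f0').
Qed.

(** As [f] may change sign, monotone convergence is applied to its positive and negative parts;
    integrability allows their limits to be subtracted. *)
Lemma Rintegral_itvoy_FTC f F (a b : R) : {in D, continuous f} ->
  mu.-integrable D (EFin \o f) ->
  (forall x : R, 0 < x -> is_derive x 1 F (f x)) ->
  F n.+2%:R^-1 @[n --> \oo] --> a -> F n.+2%:R @[n --> \oo] --> b ->
  \int[mu]_(x in D) f x = b - a.
Proof.
move=> cf intf dF Fa Fb.
have mf : measurable_fun D (EFin \o f) := measurable_itvoy cf.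
have cP := cvg_integral_itvoy (measurable_funepos mf)
  (fun x _ => funepos_ge0 (EFin \o f) x).
have cN := cvg_integral_itvoy (measurable_funeneg mf)
  (fun x _ => funeneg_ge0 (EFin \o f) x).
have finP := integrable_pos_fin_num _ intf.
have finN := integrable_neg_fin_num _ intf.
have : (\int[mu]_(x in A n) (EFin \o f) x)%E @[n --> \oo]
    --> (\int[mu]_(x in D) (EFin \o f) x)%E.
  rewrite [X in _ --> X]integralE; under eq_fun do rewrite integralE.
  by apply: cvgeB => //; rewrite fin_num_adde_defr// finP.
have -> : (fun n => \int[mu]_(x in A n) (EFin \o f) x)%E =
    (fun n => (F n.+2%:R - F n.+2%:R^-1)%:E).
  by apply/funext => n; rewrite (integral_itvoy_FTC n cf dF).
have : (F n.+2%:R - F n.+2%:R^-1)%:E @[n --> \oo] --> (b - a)%:E.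
  by apply: cvg_EFin; [exact: nearW|exact: cvgB].
by move=> c1 c2; have := cvg_unique _ c2 c1; rewrite /Rintegral /= => ->.
Qed.

Lemma integrable_itvoyZl f (c : R) : mu.-integrable D (EFin \o f) ->
  mu.-integrable D (EFin \o (fun y => c * f y)).
Proof.
move=> intf; rewrite (_ : EFin \o _ = (fun y => (c%:E * (EFin \o f) y)%E))//.
exact: integrableZl.
Qed.

Lemma integrable_itvoyB f g : mu.-integrable D (EFin \o f) ->
  mu.-integrable D (EFin \o g) -> mu.-integrable D (EFin \o (fun y => f y - g y)).
Proof.
move=> intf intg.
rewrite (_ : EFin \o _ = ((EFin \o f) \- (EFin \o g))%E)//.
exact: integrableB.
Qed.

End ImproperIntegral.

(** * Moments of the shifted Gaussian on the half-line *)

Section GaussianMoments.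
Variable R : realType.
Implicit Types (a b x y : R).
Local Notation mu := (@lebesgue_measure R).
Local Notation D := (`]0, +oo[%classic : set R).

Let Dgt0 x : D x -> 0 < x. Proof. by rewrite /= in_itv/= andbT. Qed.

(** For [a = - (2 lam)] the integral of this kernel is [phi lam] by definition. *)
Definition kern a x y : R := y `^ a * expR (- ((y - x) ^+ 2 / 2)).
Definition moment a x : R := \int[mu]_(y in D) kern a x y.

Lemma is_derive_fun_powR a y : 0 < y ->
  is_derive y 1 (fun t : R => t `^ a) (a * y `^ (a - 1)).
Proof. exact: is_derive1_powR. Qed.

Lemma is_derive_kern a x y : 0 < y ->
  is_derive y 1 (kern a x) (a * kern (a - 1) x y - (y - x) * kern a x y).
Proof.
move=> y0; have dp := is_derive_fun_powR a y0.
by rewrite /kern; derive; field.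
Qed.

Lemma continuous_kern a x : {in D, continuous (kern a x)}.
Proof.
by move=> y /set_mem/Dgt0 y0; exact: is_derive_continuous (is_derive_kern a x y0).
Qed.

Lemma kern_ge0 a x y : 0 <= kern a x y.
Proof. by rewrite mulr_ge0 ?powR_ge0 ?expR_ge0. Qed.

Lemma kern_gt0 a x y : 0 < y -> 0 < kern a x y.
Proof. by move=> y0; rewrite mulr_gt0 ?powR_gt0 ?expR_gt0. Qed.

Lemma kernS a x y : 0 < y -> kern (a + 1) x y = y * kern a x y.
Proof.
move=> y0; rewrite /kern powRD; last by rewrite (gt_eqF y0) implybT.
by rewrite powRr1 ?(ltW y0)//; ring.
Qed.

(** This is [u <= expR u] at [u = y / (2 b)], raised to the power [b]. *)
Lemma powR_le_expR b y : 0 < b -> 0 < y ->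
  y `^ b <= (2 * b) `^ b * expR (y / 2).
Proof.
move=> b0 y0; have b2 : 0 < 2 * b by rewrite mulr_gt0.
have yE : y <= 2 * b * expR (y / (2 * b)).
  rewrite mulrC -ler_pdivrMr//.
  by rewrite (le_trans _ (expR_ge1Dx _))// lerDr.
apply: (@le_trans _ _ ((2 * b * expR (y / (2 * b))) `^ b)).
  by rewrite ge0_ler_powR ?nnegrE ?(ltW b0) ?(ltW y0)// mulr_ge0 ?expR_ge0 ?ltW.
rewrite powRM ?expR_ge0 ?(ltW b2)// ler_pM2l ?powR_gt0// -expRM ler_expR.
by rewrite le_eqVlt; apply/orP; left; apply/eqP; field; rewrite gt_eqF.
Qed.

(* Up to a constant, the integrand is dominated by the derivative of the bounded
   function [- (1 + y^(a + 1))^-1]. *)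
Lemma integrable_powR_expRN a : -1 < a ->
  mu.-integrable D (EFin \o (fun y => y `^ a * expR (- y))).
Proof.
move=> a1; pose b := a + 1; have b0 : 0 < b by rewrite /b; lra.
have pos y : 0 < 1 + y `^ b by rewrite ltr_pwDl// powR_ge0.
pose f y := b * y `^ a / (1 + y `^ b) ^+ 2.
have dF y : 0 < y -> is_derive y 1 (fun t => - (1 + t `^ b)^-1) (f y).
  move=> y0; have dp := is_derive_fun_powR b y0.
  have dV : is_derive y 1 (fun t => (1 + t `^ b)^-1)
      (- (b * y `^ (b - 1)) / (1 + y `^ b) ^+ 2).
    apply: is_derive_funV; first by rewrite gt_eqF.
    by derive; ring.
  derive; rewrite /f /b addrK; field; by rewrite gt_eqF ?pos.
have cf : {in D, continuous f}.
  move=> y /set_mem/Dgt0 y0.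
  have dV : is_derive y 1 (fun t => ((1 + t `^ b) ^+ 2)^-1)
      (- (2 * (1 + y `^ b) * (b * y `^ (b - 1))) / (1 + y `^ b) ^+ 2 ^+ 2).
    have dp := is_derive_fun_powR b y0.
    apply: is_derive_funV; first by rewrite gt_eqF// exprn_gt0.
    by derive; ring.
  have dp := is_derive_fun_powR a y0.
  apply: (@is_derive_continuous _ _ _ (
    b * y `^ a * (- (2 * (1 + y `^ b) * (b * y `^ (b - 1))) / (1 + y `^ b) ^+ 2 ^+ 2)
    + b * (a * y `^ (a - 1)) * ((1 + y `^ b) ^+ 2)^-1)).
  by rewrite /f; derive; ring.
have intf : mu.-integrable D (EFin \o f).
  apply: (@integrable_itvoy_FTC _ _ (fun t => - (1 + t `^ b)^-1) 1) => //.
    by move=> y y0; rewrite divr_ge0 ?exprn_ge0 ?mulr_ge0 ?powR_ge0// ltW.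
  move=> y y0; rewrite normrN ger0_norm ?invr_ge0 ?(ltW (pos _))//.
  by rewrite invf_le1// lerDl powR_ge0.
pose c := (2 * b) `^ b; have c0 : 0 <= c by exact: powR_ge0.
have := integrable_itvoyZl ((1 + c) ^+ 2 / b) intf.
apply: le_integrable => //.
  apply: measurable_itvoy => y /set_mem/Dgt0 y0.
  have dp := is_derive_fun_powR a y0.
  by notypeclasses refine (is_derive_continuous _); repeat derive_step.
move=> y /Dgt0 y0; rewrite /= lee_fin ger0_norm ?mulr_ge0 ?powR_ge0 ?expR_ge0//.
rewrite (le_trans _ (ler_norm _))// /f.
have -> : (1 + c) ^+ 2 / b * (b * y `^ a / (1 + y `^ b) ^+ 2) =
    y `^ a * ((1 + c) ^+ 2 / (1 + y `^ b) ^+ 2).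
  by field; rewrite !gt_eqF.
rewrite ler_pM2l ?powR_gt0// ler_pdivlMr ?exprn_gt0//.
rewrite expRN ler_pdivrMl ?expR_gt0//.
(* Taking square roots leaves [1 + y^b <= (1 + c) expR (y / 2)], which is [powR_le_expR] added to
   [1 <= expR (y / 2)]. *)
have -> : expR y * (1 + c) ^+ 2 = (expR (y / 2) * (1 + c)) ^+ 2.
  by rewrite exprMn -expRM_natl; congr (expR _ * _); field.
have e1 : 1 <= expR (y / 2) by rewrite (le_trans _ (expR_ge1Dx _))// lerDl divr_ge0// ltW.
rewrite ler_sqr ?nnegrE ?mulr_ge0 ?expR_ge0 ?addr_ge0 ?powR_ge0//.
have := powR_le_expR b0 y0; rewrite -/c; lra.
Qed.

(** A domination uniform in [x]; the factor [1 + |y - x|] covers the [x]-derivative too. With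
    [s = |y - x|], [1 + s <= expR s] and [s - s^2 / 2 <= 2 - s <= 2 + r - y]. *)
Lemma kern_le a x y r : 0 < y -> `|x| <= r ->
  (1 + `|y - x|) * kern a x y <= expR (2 + r) * (y `^ a * expR (- y)).
Proof.
move=> y0 xr; rewrite /kern !mulrA [leLHS]mulrAC [leRHS]mulrAC ler_wpM2r ?powR_ge0//.
rewrite (le_trans (ler_wpM2r (expR_ge0 _) (expR_ge1Dx _)))// -!expRD ler_expR.
have h1 : y - r <= `|y - x|.
  by rewrite (le_trans _ (ler_norm _))// lerD2l lerN2 (le_trans (ler_norm _)).
have -> : (y - x) ^+ 2 = `|y - x| ^+ 2 by rewrite real_normK// num_real.
by have := sqr_ge0 (`|y - x| - 2); nra.
Qed.

Lemma kern_le0 a x y : 0 < y ->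
  kern a x y <= expR (2 + `|x|) * (y `^ a * expR (- y)).
Proof.
move=> y0; apply: le_trans (kern_le a y0 (lexx _)).
by rewrite ler_peMl ?kern_ge0// lerDl.
Qed.

Lemma integrable_kern a x : -1 < a -> mu.-integrable D (EFin \o kern a x).
Proof.
move=> a1.
have := integrable_itvoyZl (expR (2 + `|x|)) (integrable_powR_expRN a1).
apply: le_integrable => //.
  by apply: measurable_itvoy => y yD; exact: continuous_kern.
move=> y /Dgt0 y0; rewrite /= lee_fin ger0_norm ?kern_ge0//.
by rewrite (le_trans _ (ler_norm _))// kern_le0.
Qed.

(** The kernel has a positive minimum on [[1, 2]], an interval of length [1], and this minimum
    bounds the integral from below. *)
Lemma moment_gt0 a x : -1 < a -> 0 < moment a x.
Proof.
move=> a1; have [|c c12 cmin] := @EVT_min _ (kern a x) 1 2 (ltW (ltr1n _ 2)).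
  apply: continuous_in_subspaceT => y /set_mem/=; rewrite in_itv/= => /andP[y1 _].
  by apply: continuous_kern; apply/mem_set; rewrite /= in_itv/= (lt_le_trans _ y1).
have c0 : 0 < c by move: c12; rewrite in_itv/= => /andP[c1 _]; exact: lt_le_trans c1.
pose I : set R := `[1, 2]%classic; have mI : measurable I by exact: measurable_itv.
have sub : I `<=` D.
  move=> y; rewrite /I /= !in_itv/= andbT => /andP[y1 _].
  exact: lt_le_trans y1.
rewrite -lte_fin /moment /Rintegral fineK; last first.
  by apply: integrable_fin_num => //; exact: integrable_kern.
apply: (@lt_le_trans _ _ (kern a x c)%:E); first by rewrite lte_fin kern_gt0.
have int12 : (\int[mu]_(y in I) (kern a x y)%:E <=
    \int[mu]_(y in D) (kern a x y)%:E)%E.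
  apply: ge0_subset_integral => //.
  - by have /integrableP[] := integrable_kern x a1.
  - by move=> y _; rewrite lee_fin kern_ge0.
apply: le_trans int12; have -> : (kern a x c)%:E = (\int[mu]_(y in I) (kern a x c)%:E)%E.
  rewrite integral_cst//= /I lebesgue_measure_itv/= lte_fin ltr1n -EFinB -EFinM.
  by congr EFin; ring.
apply: ge0_le_integral => //.
- by move=> y _; rewrite lee_fin kern_ge0.
- have /integrableP[mk _] := integrable_kern x a1.
  exact: measurable_funS sub mk.
Qed.

Lemma is_derive_moment_kern a x : -1 < a ->
  is_derive x 1 (moment a) (\int[mu]_(y in D) ((y - x) * kern a x y)).
Proof.
move=> a1; have dK (t y : R) : is_derive t 1 (kern a ^~ y) ((y - t) * kern a t y).
  by rewrite /kern; derive; field.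
(* The bound of [kern_le] for [r = 1 + |x|], valid for every [t] within [1] of [x]. *)
pose g y := expR (3 + `|x|) * (y `^ a * expR (- y)).
have xI : `]x - 1, x + 1[%classic x by rewrite /= in_itv/=; apply/andP; split; lra.
have intK t : `]x - 1, x + 1[%classic t -> mu.-integrable D (EFin \o kern a t).
  by move=> _; exact: integrable_kern.
have derK t y : `]x - 1, x + 1[%classic t -> D y -> derivable (kern a ^~ y) t 1.
  by move=> _ _; have [] := dK t y.
have g0 y : 0 <= g y by rewrite !mulr_ge0 ?expR_ge0 ?powR_ge0.
have intg : mu.-integrable D (EFin \o g).
  exact: integrable_itvoyZl (integrable_powR_expRN a1).
have d1E t y : partial1of2 (kern a) t y = (y - t) * kern a t y.
  exact: is_derive_derive1.
have gub t y : `]x - 1, x + 1[%classic t -> D y ->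
    `|partial1of2 (kern a) t y| <= g y.
  rewrite /= in_itv/= => /andP[t1 t2] /Dgt0 y0.
  rewrite d1E normrM (ger0_norm (kern_ge0 _ _ _)).
  have tr : `|t| <= 1 + `|x|.
    have := ler_norm x; have := ler_norm (- x); rewrite normrN ler_norml => h1 h2.
    by apply/andP; split; lra.
  have := kern_le a y0 tr; rewrite /g addrA => h.
  apply: le_trans (_ : (1 + `|y - t|) * kern a t y <= _).
    by rewrite ler_wpM2r ?kern_ge0// lerDr.
  by move: h; rewrite (_ : 2 + 1 = 3)//; ring.
split; first by apply: (@derivable_under_integral _ _ _ mu _ _ _ _ _ _ xI _ _ g).
rewrite -derive1E (@differentiation_under_integral _ _ _ mu _ _ _ _ _ _ xI _ _ g)//.
by apply: eq_Rintegral => y _; exact: d1E.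
Qed.

Lemma RintegralB_kern a x : -1 < a ->
  \int[mu]_(y in D) ((y - x) * kern a x y) = moment (a + 1) x - x * moment a x.
Proof.
move=> a1; have a2 : -1 < a + 1 by lra.
rewrite -RintegralZl//; last exact: integrable_kern.
rewrite -RintegralB//; [|exact: integrable_kern|]; last first.
  exact: integrable_itvoyZl (integrable_kern x a1).
by apply: eq_Rintegral => y /set_mem/Dgt0 y0; rewrite kernS//; ring.
Qed.

Lemma is_derive_moment a x : -1 < a ->
  is_derive x 1 (moment a) (moment (a + 1) x - x * moment a x).
Proof. by move=> a1; rewrite -RintegralB_kern//; exact: is_derive_moment_kern. Qed.

(** The [y]-derivative of [kern b x] integrates to [0]: the kernel vanishes at [0] since [b > 0],
    and at infinity by its decay. *)
Lemma moment_by_parts b x : 0 < b ->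
  moment (b + 1) x - x * moment b x = b * moment (b - 1) x.
Proof.
move=> b0; have b1 : -1 < b by lra.
have b2 : -1 < b - 1 by lra.
rewrite -RintegralB_kern//; apply/eqP; rewrite eq_sym -subr_eq0; apply/eqP.
have intB : mu.-integrable D (EFin \o (fun y => (y - x) * kern b x y)).
  have := integrable_itvoyB (@integrable_kern (b + 1) x _)
    (integrable_itvoyZl x (integrable_kern x b1)).
  move=> /(_ ltac:(lra)); apply: eq_integrable => // y /set_mem/Dgt0 y0 /=.
  by rewrite kernS//; congr EFin; ring.
have intA := integrable_itvoyZl b (integrable_kern x b2).
rewrite -RintegralZl//; last exact: integrable_kern.
rewrite -RintegralB//.
rewrite -[RHS](subrr 0).
apply: (@Rintegral_itvoy_FTC _ _ (kern b x)).
- move=> y yD; apply: cvgB; apply: cvgM.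
  + exact: cvg_cst.
  + exact: continuous_kern.
  + by apply: cvgB; [exact: cvg_id|exact: cvg_cst].
  + exact: continuous_kern.
- exact: integrable_itvoyB.
- by move=> y y0; exact: is_derive_kern.
- have V0 : (n.+2%:R^-1 : R) @[n --> \oo] --> 0.
    by have := @cvg_harmonic R; rewrite -(cvg_shiftS (@harmonic R)).
  apply: (@squeeze_cvgr _ _ _ _ (fun=> 0) (fun n => n.+2%:R^-1 `^ b)).
  + apply: nearW => n; rewrite kern_ge0/= ler_piMr ?powR_ge0//.
    by rewrite -expR0 ler_expR oppr_le0 divr_ge0 ?sqr_ge0.
  + exact: cvg_cst.
  + have /cvg_at_rightP := powR_cvg0 b0; apply; split => // n.
(* Half of the decay absorbs the power; the other half is at most [2 / n], because
   [n / 2 <= expR (n / 2)]. *)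
- pose C := expR (2 + `|x|) * ((2 * b) `^ b * 2).
  apply: (@squeeze_cvgr _ _ _ _ (fun=> 0) (fun n => C * n.+2%:R^-1)).
  + apply: nearW => n; rewrite kern_ge0/= (le_trans (kern_le0 _ _ _))//.
    rewrite /C -mulrA ler_pM2l ?expR_gt0//.
    have := @powR_le_expR b n.+2%:R b0 (ltr0Sn _ _) => h.
    apply: le_trans (ler_wpM2r (expR_ge0 _) h) _.
    rewrite -!mulrA ler_wpM2l ?powR_ge0// -expRD.
    rewrite (_ : _ / 2 - _ = - (n.+2%:R / 2)); last by field.
    rewrite expRN -[2 * _]invrK invfM invrK lef_pV2 ?posrE ?expR_gt0 ?mulr_gt0//.
    by rewrite mulrC (le_trans _ (expR_ge1Dx _))// lerDr.
  + exact: cvg_cst.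
  + rewrite -(mulr0 C); apply: cvgM; first exact: cvg_cst.
    by have := @cvg_harmonic R; rewrite -(cvg_shiftS (@harmonic R)).
Qed.

(* With [c] the mean of [y] for the weight [kern a x], the function
   [(y - c) (y^(b - a) - c^(b - a))] is nonpositive, hence the mean of [y] for
   [kern b x] is at most [c]. *)
Lemma moment_ratio_mono a b x : -1 < b -> b <= a ->
  moment (b + 1) x * moment a x <= moment (a + 1) x * moment b x.
Proof.
move=> b1 ba; have a1 : -1 < a by lra.
have a2 : -1 < a + 1 by lra.
have b2 : -1 < b + 1 by lra.
have ma := moment_gt0 x a1.
pose c := moment (a + 1) x / moment a x.
have c0 : 0 < c by rewrite divr_gt0// moment_gt0.
pose d := b - a; have d0 : d <= 0 by rewrite /d; lra.
rewrite -ler_pdivlMr//.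
suff : moment (b + 1) x - c * moment b x <= 0.
  by rewrite subr_le0 /c mulrAC.
(* Writing [0] as this multiple of a vanishing integral reduces the claim to a pointwise inequality
   of integrands. *)
have -> : 0 = c `^ d * (moment (a + 1) x - c * moment a x).
  by rewrite /c divfK ?gt_eqF// subrr mulr0.
have intC a' : -1 < a' -> mu.-integrable D (EFin \o (fun y => c * kern a' x y)).
  by move=> a'1; exact: integrable_itvoyZl (integrable_kern x a'1).
have intB a' : -1 < a' ->
    mu.-integrable D (EFin \o (fun y => kern (a' + 1) x y - c * kern a' x y)).
  move=> a'1; apply: integrable_itvoyB (intC _ a'1).
  by apply: integrable_kern; lra.
have E a' : -1 < a' -> moment (a' + 1) x - c * moment a' x =
    \int[mu]_(y in D) (kern (a' + 1) x y - c * kern a' x y).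
  move=> a'1; rewrite RintegralB//; [|by apply: integrable_kern; lra|exact: intC].
  by rewrite RintegralZl//; exact: integrable_kern.
rewrite !E// -RintegralZl//; last exact: intB.
apply: le_Rintegral => //; first exact: intB.
  exact: integrable_itvoyZl (intB _ a1).
move=> y /Dgt0 y0; rewrite !kernS//.
have -> : kern b x y = y `^ d * kern a x y.
  rewrite /kern mulrA -powRD; last by rewrite (gt_eqF y0) implybT.
  by rewrite /d subrK.
rewrite -subr_ge0.
have -> : c `^ d * (y * kern a x y - c * kern a x y) -
  (y * (y `^ d * kern a x y) - c * (y `^ d * kern a x y)) =
  kern a x y * ((y - c) * (c `^ d - y `^ d)) by ring.
rewrite mulr_ge0 ?kern_ge0//.
have anti s t : 0 < s -> s <= t -> t `^ d <= s `^ d.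
  move=> s0 st; have t0 : 0 < t by exact: lt_le_trans st.
  rewrite -[d]opprK (powRN t) (powRN s) lef_pV2 ?posrE ?powR_gt0//.
  by rewrite ge0_ler_powR ?nnegrE ?oppr_ge0 ?(ltW s0) ?(ltW t0).
have [yc|cy] := leP y c.
  by rewrite mulr_le0 ?subr_le0 ?anti.
by rewrite mulr_ge0 ?subr_ge0 ?anti// ltW.
Qed.

(** The relation for [th] is the integration by parts at the exponent [1 - 2 l], positive because
    [l < 1/2]. *)
Lemma phi_profile (l : R) : 0 < l < 2^-1 ->
  is_profile l (phi l) (moment (1 - 2 * l)).
Proof.
move=> /[dup] l01 /andP[l0 l1].
have a1 : -1 < - (2 * l) by lra.
have aE : 1 - 2 * l = - (2 * l) + 1 by rewrite addrC.
split => // x.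
- exact: moment_gt0.
- by apply: moment_gt0; lra.
- by rewrite aE; exact: is_derive_moment.
- have b0 : 0 < 1 - 2 * l by lra.
  have -> : phi l x = moment (1 - 2 * l - 1) x.
    by rewrite [1 - _]addrC addrK.
  by rewrite -moment_by_parts//; apply: is_derive_moment; lra.
Qed.

End GaussianMoments.

(** * The glued profile [H] *)

Section Inflection.
Variable R : realType.
Implicit Types (l lam sigma x : R).

Local Notation psi l := (moment (1 - 2 * l)).
Local Notation f2 l := (prof2 l (phi l) (psi l)).
Local Notation e2 l := (even2 l (phi l) (psi l)).

Lemma phi''E l x : 0 < l < 2^-1 -> phi'' l x = f2 l x.
Proof.
move=> l01; have P := phi_profile l01.
rewrite /phi'' /= (_ : derive1 (phi l) = prof1 (phi l) (psi l)).
  exact: is_derive_derive1 (is_derive_prof1 P x).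
by apply/funext => y; exact: is_derive_derive1 (is_derive_prof P y).
Qed.

Lemma x1P l : 0 < l < 2^-1 -> x1 l < 0 /\ f2 l (x1 l) = 0.
Proof.
move=> l01; have [x x0 e] := prof_neg_inflection (phi_profile l01).
rewrite -phi''E//; apply: (xgetPex 0 (P := [set x | x < 0 /\ phi'' l x = 0])).
by exists x; rewrite /= phi''E.
Qed.

Lemma zP l : 0 < l < 2^-1 -> 0 < z l /\ e2 l (z l) = 0.
Proof.
move=> l01; have [x x0 e] := even_inflection (phi_profile l01).
rewrite /even2 -!phi''E//.
apply: (xgetPex 0 (P := [set x | 0 < x /\ phi'' l x + phi'' l (- x) = 0])).
by exists x; rewrite /= !phi''E.
Qed.

(** Positivity rules out the default value [0] of [xget]. *)
Lemma lambda_P sigma : 0 < lambda_ sigma ->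
  0 < lambda_ sigma < 2^-1 /\ sigma_ (lambda_ sigma) = sigma.
Proof.
rewrite /lambda_; case: xgetP => [l -> //|_]; by rewrite ltxx.
Qed.

(** At [lambda_ sigma] the point [- sigma z] is the negative inflection point itself; the comparison
    in [l] carries the sign to smaller parameters. *)
Lemma prof2_opp_sigma_z_ge0 sigma lam : 0 < sigma < 1 ->
  0 < lam <= lambda_ sigma ->
  0 < lam < 2^-1 /\ 0 <= f2 lam (- (sigma * z lam)).
Proof.
move=> s01 /andP[l0 ll'].
have [l'01 sE] := lambda_P (lt_le_trans l0 ll').
move: (lambda_ sigma) ll' l'01 sE => l' ll' l'01 sE.
have l01 : 0 < lam < 2^-1 by rewrite l0; case/andP: l'01 => _; exact: le_lt_trans.
split=> //.
have P := phi_profile l01; have P' := phi_profile l'01.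
have th_le x : psi l' x * phi lam x <= psi lam x * phi l' x.
  have aE k : 1 - 2 * k = - (2 * k) + 1 by rewrite addrC.
  by rewrite !aE; apply: moment_ratio_mono; move: l'01; lra.
have [x0 fx] := x1P l01; have [x'0 fx'] := x1P l'01.
have [z0 fz] := zP l01; have [z'0 fz'] := zP l'01.
have x'E : - x1 l' = sigma * z l'.
  by rewrite -[in RHS]sE /sigma_ divfK// lt0r_neq0.
exact: (prof2_opp_scale_ge0 P P' ll' s01 (th_le _) x0 fx z0 fz x'0 fx' z'0 fz' x'E).
Qed.

End Inflection.

(** * Glueing of differentiable functions *)

Section Glueing.
Variable R : realType.
Implicit Types (F G K : R -> R) (a c x : R).

(** At [c], subtracting [F] leaves [k = G - F] cut off on the left. Its difference quotient is at
    most that of [k] in absolute value, and the latter tends to [0]. *)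
Lemma is_derive_glue c F G (dF dG : R -> R) x :
  (forall y : R, is_derive y 1 F (dF y)) ->
  (forall y : R, is_derive y 1 G (dG y)) ->
  F c = G c -> dF c = dG c ->
  is_derive x 1 (fun y => if y <= c then F y else G y)
    (if x <= c then dF x else dG x).
Proof.
move=> dFP dGP FG dFG.
have [xc|cx|->] := ltgtP x c.
- apply: near_eq_is_derive (dFP x); near=> y.
  by rewrite ifT// ltW//; near: y; exact: lt_nbhsl.
- apply: near_eq_is_derive (dGP x); near=> y.
  by rewrite ifF//; apply/negbTE; rewrite -ltNge; near: y; exact: lt_nbhsr.
- pose k y : R := G y - F y.
  pose k' y : R := if y <= c then 0 else k y.
  have dk : is_derive c 1 k 0 by rewrite /k; derive; rewrite dFG; ring.
  have kc : k c = 0 by rewrite /k FG subrr.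
  suff dk' : is_derive c 1 k' 0.
    have -> : (fun y => if y <= c then F y else G y) = (fun y => F y + k' y).
      by apply/funext => y; rewrite /k' /k; case: ifP => _; ring.
    by derive; ring.
  have cvgk : h^-1 *: (k (h *: 1 + c) - k c) @[h --> 0^'] --> (0 : R).
    by case: dk => dk1 dk2; rewrite -[X in _ --> X]dk2; exact: dk1.
  have cvgk' : h^-1 *: (k' (h *: 1 + c) - k' c) @[h --> 0^'] --> (0 : R).
    apply/cvgr0Pnorm_le => e e_gt0; move/cvgr0Pnorm_le : cvgk => /(_ _ e_gt0).
    apply: filterS => h; apply: le_trans; rewrite !normrM ler_wpM2l//.
    by rewrite /k' kc lexx !subr0; case: ifP => _; rewrite ?normr0.
  split; first by apply/cvg_ex; exists 0.
  by apply: cvg_lim.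
Unshelve. all: by end_near. Qed.

Definition piecewise a F G K x : R :=
  if x <= - a then F x else if x < a then G x else K x.

(** Two glueings; the strict test [x < a], which follows [H], may be weakened because the branches
    agree at [a]. *)
Lemma is_derive_piecewise a F G K (dF dG dK : R -> R) x : 0 < a ->
  (forall y : R, is_derive y 1 F (dF y)) ->
  (forall y : R, is_derive y 1 G (dG y)) ->
  (forall y : R, is_derive y 1 K (dK y)) ->
  F (- a) = G (- a) -> dF (- a) = dG (- a) -> G a = K a -> dG a = dK a ->
  is_derive x 1 (piecewise a F G K) (piecewise a dF dG dK x).
Proof.
move=> a0 dFP dGP dKP FG dFG GK dGK.
have ltle f g y : f a = g a ->
    (if y < a then f y else g y) = (if y <= a then f y else g y) :> R.
  by move=> fg; case: ltgtP => // ->.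
have Na : - a <= a by lra.
have -> : piecewise a F G K =
    (fun y => if y <= - a then F y else if y <= a then G y else K y).
  by apply/funext => y; rewrite /piecewise ltle.
rewrite /piecewise ltle//.
apply: (@is_derive_glue (- a) F _ dF (fun y => if y <= a then dG y else dK y)) => //.
- by move=> y; exact: is_derive_glue.
- by rewrite Na.
- by rewrite Na.
Qed.

End Glueing.

(** * Regularity of the glued profile and its nonlinear equation *)

Section GluedProfile.
Variable R : realType.
Variables (l sigma z : R) (f th : R -> R).
Implicit Types (x : R).
Hypotheses (P : is_profile l f th) (sigma01 : 0 < sigma < 1) (z_gt0 : 0 < z).
Hypothesis (e2z : even2 l f th z = 0).
Local Notation a := (sigma * z).
Hypothesis (f2a_ge0 : 0 <= prof2 l f th (- a)).
Local Notation f1 := (prof1 f th).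
Local Notation f2 := (prof2 l f th).
Local Notation e0 := (even0 f).
Local Notation e1 := (even1 f th).
Local Notation e2 := (even2 l f th).

(* [outer_coef1] and [outer_coef2] are the paper's [mu_1] and [mu_2]. *)
Definition outer_coef1 :=
  f2 a * (f (- z) + f z) / (f (- a) * f2 a - f a * f2 (- a)).
Definition outer_coef2 :=
  f2 (- a) * (f (- z) + f z) / (f a * f2 (- a) - f (- a) * f2 a).
Local Notation c1 := outer_coef1.
Local Notation c2 := outer_coef2.

(** The right branch; exchanging the two coefficients on the left makes the left branch its mirror
    image. *)
Definition outer0 x := c2 * f x + c1 * f (- x).
Definition outer1 x := c2 * f1 x - c1 * f1 (- x).
Definition outer2 x := c2 * f2 x + c1 * f2 (- x).

Definition profileH := piecewise a (fun x => outer0 (- x))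
  (fun x => e0 (x / sigma)) outer0.
Definition profileH1 := piecewise a (fun x => - outer1 (- x))
  (fun x => e1 (x / sigma) / sigma) outer1.
Definition profileH2 := piecewise a (fun x => outer2 (- x))
  (fun x => e2 (x / sigma) / sigma ^+ 2) outer2.

Let s0 : 0 < sigma. Proof. by case/andP: sigma01. Qed.
Let a_gt0 : 0 < a. Proof. by rewrite mulr_gt0 ?s0. Qed.
Let az : a < z. Proof. by case/andP: sigma01 => _ s1; rewrite gtr_pMl. Qed.
Let f_gt0 x : 0 < f x. Proof. by case: P. Qed.

Lemma f2a_lt0 : f2 a < 0.
Proof.
apply: (prof2_lt0 P (ltW a_gt0) f2a_ge0 az e2z).
by rewrite (ltW a_gt0) (ltW az).
Qed.

Lemma coef_den_gt0 : 0 < f a * f2 (- a) - f (- a) * f2 a.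
Proof.
by rewrite ltr_wpDl// ?oppr_gt0 ?pmulr_rlt0 ?f_gt0 ?f2a_lt0// mulr_ge0// ltW// f_gt0.
Qed.

Lemma outer_coef1E :
  c1 = - f2 a * (f (- z) + f z) / (f a * f2 (- a) - f (- a) * f2 a).
Proof.
rewrite /outer_coef1 -[f (- a) * f2 a - _]opprB invrN mulrN.
by rewrite !mulNr.
Qed.

Lemma outer_coef1_gt0 : 0 < c1.
Proof.
rewrite outer_coef1E divr_gt0 ?coef_den_gt0// mulr_gt0 ?oppr_gt0 ?f2a_lt0//.
by rewrite addr_gt0 ?f_gt0.
Qed.

Lemma outer_coef2_ge0 : 0 <= c2.
Proof.
rewrite /outer_coef2 divr_ge0 ?(ltW coef_den_gt0)// mulr_ge0//.
by rewrite addr_ge0// ltW// f_gt0.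
Qed.

Lemma outer0_gt0 x : 0 < outer0 x.
Proof.
apply: ltr_wpDl; last by rewrite mulr_gt0 ?outer_coef1_gt0 ?f_gt0.
by rewrite mulr_ge0 ?outer_coef2_ge0// ltW// f_gt0.
Qed.

Lemma profileH_gt0 x : 0 < profileH x.
Proof.
rewrite /profileH /piecewise; case: ifP => _; first exact: outer0_gt0.
by case: ifP => _; [exact: (even0_gt0 P)|exact: outer0_gt0].
Qed.

Lemma profileH_bounded : exists M, forall x, profileH x <= M.
Proof.
have [M fM] := prof_bounded P; exists (c2 * M + c1 * M + (M + M)) => x.
have M0 : 0 <= M by rewrite (le_trans (ltW (f_gt0 0))).
have c1M := mulr_ge0 (ltW outer_coef1_gt0) M0.
have c2M := mulr_ge0 outer_coef2_ge0 M0.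
have oM y : outer0 y <= c2 * M + c1 * M.
  by rewrite lerD// ler_wpM2l ?outer_coef2_ge0// ltW// outer_coef1_gt0.
rewrite /profileH /piecewise; case: ifP => _; first by have := oM (- x); lra.
case: ifP => _; last by have := oM x; lra.
by rewrite /even0; have := fM (x / sigma); have := fM (- (x / sigma)); lra.
Qed.

Lemma outer2E x : outer2 x = - x * outer1 x - 2 * l * outer0 x.
Proof. by rewrite /outer2 /outer1 /outer0 /prof2; ring. Qed.

(** The two coefficients are the solution of the linear system formed by this equation and
    [outer2 a = 0]. *)
Lemma outer0a : outer0 a = e0 z.
Proof.
rewrite /outer0 outer_coef1E /outer_coef2 /even0; field.
by rewrite gt_eqF// coef_den_gt0.
Qed.

Lemma outer2a : outer2 a = 0.
Proof. by rewrite /outer2 outer_coef1E /outer_coef2; ring. Qed.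

(** The slopes match because of the equations: both second derivatives vanish at the junction, so
    [a outer1 a = - 2 l e0 z = z e1 z]. *)
Lemma outer1a : outer1 a = e1 z / sigma.
Proof.
have := outer2a; rewrite outer2E outer0a => o2.
have := e2z; rewrite even2E => ez.
apply: (mulfI (lt0r_neq0 a_gt0)).
have -> : a * (e1 z / sigma) = z * e1 z by field; rewrite gt_eqF ?s0.
by move: o2 ez; lra.
Qed.

Lemma outer2_ge0 x : a <= x -> 0 <= outer2 x.
Proof.
move=> ax; have := prof2_cross_ge0 P (ltW a_gt0) f2a_ge0 az e2z ax.
have -> : outer2 x = (f2 (- a) * f2 x - f2 a * f2 (- x)) *
    ((f (- z) + f z) / (f a * f2 (- a) - f (- a) * f2 a)).
  by rewrite /outer2 outer_coef1E /outer_coef2; ring.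
move=> h; rewrite mulr_ge0// divr_ge0 ?(ltW coef_den_gt0)//.
by rewrite addr_ge0// ltW// f_gt0.
Qed.

Lemma even2_le0 x : - a < x -> x < a -> e2 (x / sigma) <= 0.
Proof.
move=> ax xa; wlog x0 : x ax xa / 0 <= x => [hw|].
  have [x0|x0] := leP 0 x; first exact: hw.
  have -> : e2 (x / sigma) = e2 (- x / sigma).
    by rewrite mulNr /even2 opprK addrC.
  by apply: hw; lra.
apply/ltW/(even2_lt0 P (ltW a_gt0) f2a_ge0 az e2z).
by rewrite divr_ge0 ?(ltW s0)//= ltr_pdivrMr ?s0// mulrC.
Qed.

Lemma a_div_sigma : a / sigma = z.
Proof. by rewrite mulrC mulKf// gt_eqF ?s0. Qed.

Lemma even1N x : e1 (- x) = - e1 x.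
Proof. by rewrite /even1 [in - - x]opprK; ring. Qed.

Lemma even0N x : e0 (- x) = e0 x.
Proof. by rewrite /even0 opprK addrC. Qed.

Lemma even2N x : e2 (- x) = e2 x.
Proof. by rewrite /even2 opprK addrC. Qed.

Lemma is_derive_outer0 x : is_derive x 1 outer0 (outer1 x).
Proof.
have df := is_derive_prof P.
by rewrite /outer0; derive; rewrite /outer1; ring.
Qed.

Lemma is_derive_outer1 x : is_derive x 1 outer1 (outer2 x).
Proof.
have df := is_derive_prof1 P.
by rewrite /outer1; derive; rewrite /outer2; ring.
Qed.

Lemma is_derive_profileH x : is_derive x 1 profileH (profileH1 x).
Proof.
rewrite /profileH /profileH1; apply: is_derive_piecewise.
- exact: a_gt0.
- by move=> y; have d0 := is_derive_outer0; derive; ring.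
- by move=> y; have d0 := is_derive_even0 P; derive; ring.
- exact: is_derive_outer0.
- by rewrite opprK outer0a mulNr even0N a_div_sigma.
- by rewrite opprK outer1a (mulNr _ sigma^-1) even1N a_div_sigma mulNr.
- by rewrite outer0a a_div_sigma.
- by rewrite outer1a a_div_sigma.
Qed.

Lemma is_derive_profileH1 x : is_derive x 1 profileH1 (profileH2 x).
Proof.
rewrite /profileH1 /profileH2; apply: is_derive_piecewise.
- exact: a_gt0.
- by move=> y; have d0 := is_derive_outer1; derive; ring.
- move=> y; have d0 := is_derive_even1 P; derive; field.
  by rewrite gt_eqF ?s0.
- exact: is_derive_outer1.
- by rewrite opprK outer1a (mulNr _ sigma^-1) even1N a_div_sigma mulNr.
- by rewrite opprK outer2a (mulNr _ sigma^-1) even2N a_div_sigma e2z mul0r.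
- by rewrite outer1a a_div_sigma.
- by rewrite outer2a a_div_sigma e2z mul0r.
Qed.

Lemma G_ge0 x : 0 <= x -> G sigma x = x / 2.
Proof.
move=> x0; rewrite /G /pos_part /neg_part /pos_part max_r// max_l ?oppr_le0//.
by field.
Qed.

Lemma G_le0 x : x <= 0 -> G sigma x = sigma ^+ 2 * x / 2.
Proof.
move=> x0; rewrite /G /pos_part /neg_part /pos_part max_l// max_r ?oppr_ge0//.
by field.
Qed.

(** The sign of the second derivative selects the linear branch of [G] on each piece; in the middle
    its [sigma ^+ 2] cancels the one from rescaling [x]. *)
Lemma profileH_eq x :
  G sigma (profileH2 x) = - (x * profileH1 x / 2 + l * profileH x).
Proof.
rewrite /profileH2 /profileH1 /profileH /piecewise; case: ifPn => [xa|].
  rewrite G_ge0; last by rewrite outer2_ge0//; lra.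
  by rewrite outer2E; field.
rewrite -ltNge => xa; case: ifPn => [xa'|].
  rewrite G_le0; last by rewrite mulr_le0_ge0 ?invr_ge0 ?sqr_ge0// even2_le0.
  by rewrite even2E; field; rewrite gt_eqF ?s0.
by rewrite -leNgt => xa'; rewrite G_ge0 ?outer2_ge0// outer2E; field.
Qed.

(* [G] is inverted explicitly, so that the continuity of [H''] follows from
   that of [H] and [H'] without a discussion of the glueing points. *)
Lemma G_inv x : x = 2 * Num.max 0 (G sigma x)
  - 2 / sigma ^+ 2 * Num.max 0 (- G sigma x).
Proof.
have [x0|x0] := leP 0 x.
  rewrite G_ge0// max_r ?divr_ge0// max_l ?oppr_le0 ?divr_ge0//.
  by field; rewrite gt_eqF ?s0.
have ss : 0 < sigma ^+ 2 by rewrite exprn_gt0 ?s0.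
have sx : sigma ^+ 2 * x / 2 <= 0 by rewrite pmulr_lle0// pmulr_rle0// ltW.
rewrite G_le0 ?ltW// max_l// max_r ?oppr_ge0//; field; by rewrite gt_eqF ?s0.
Qed.

Lemma continuous_profileH2 : continuous profileH2.
Proof.
have -> : profileH2 = (fun x =>
   2 * Num.max 0 (- (x * profileH1 x / 2 + l * profileH x))
   - 2 / sigma ^+ 2 * Num.max 0 (x * profileH1 x / 2 + l * profileH x)).
  by apply/funext => x; rewrite {1}[LHS]G_inv profileH_eq opprK.
have cb : continuous (fun x => x * profileH1 x / 2 + l * profileH x).
  move=> x; have d0 := is_derive_profileH; have d1 := is_derive_profileH1.
  by notypeclasses refine (is_derive_continuous _); repeat derive_step.
have cmax (g : R -> R) : continuous g -> continuous (fun x => Num.max 0 (g x)).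
  by move=> cg x; apply: continuous_max => //; [exact: cvg_cst|exact: cg].
have cNb : continuous (fun x => - (x * profileH1 x / 2 + l * profileH x)).
  by move=> x; apply: cvgN; exact: cb.
move=> x; apply: cvgB; (apply: cvgM; first exact: cvg_cst).
- exact: (cmax _ cNb x).
- exact: (cmax _ cb x).
Qed.

End GluedProfile.

(** * Self-similar solutions and uniqueness *)

Section LocalExtrema.
Variable R : realType.
Implicit Types (f : R -> R) (x c : R).

Lemma is_derive_gt0_right f x c : is_derive x 1 f c -> 0 < c ->
  exists2 d, 0 < d & forall h, 0 < h < d -> f x < f (x + h).
Proof.
move=> [df fc] c0.
have cf : h^-1 *: (f (h *: 1 + x) - f x) @[h --> 0^'] --> c.
  by rewrite -[X in _ --> X]fc; exact: df.
have [d /= d0 dP] := cvgr_gt _ cf _ c0.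
exists d => // h /andP[h0 hd].
have := dP h; rewrite /= sub0r normrN gtr0_norm// => /(_ hd (lt0r_neq0 h0)).
by rewrite /GRing.scale/= mulr1 pmulr_rgt0 ?invr_gt0// subr_gt0 addrC.
Qed.

Lemma nbhs_right_ball x (Q : R -> Prop) : (\forall y \near x, Q y) ->
  exists2 d, 0 < d & forall h, 0 < h < d -> Q (x + h).
Proof.
move=> [d /= d0 dP]; exists d => // h /andP[h0 hd]; apply: dP => /=.
by rewrite opprD addrA subrr sub0r normrN gtr0_norm.
Qed.

Lemma local_max_derive_le0 f x c : is_derive x 1 f c ->
  (\forall y \near x, f y <= f x) -> c <= 0.
Proof.
move=> df fmax; rewrite leNgt; apply/negP => c0.
have [d d0 dP] := is_derive_gt0_right df c0.
have [e e0 eP] := nbhs_right_ball fmax.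
pose h := Num.min d e / 2.
have m0 : 0 < Num.min d e by rewrite lt_min d0.
have h0 : 0 < h by rewrite divr_gt0.
have hm : h < Num.min d e by rewrite ltr_pdivrMr// ltr_pMr// ltr1n.
move: hm; rewrite lt_min => /andP[hd he].
have := dP h; rewrite h0 hd => /(_ isT); apply/negP; rewrite -leNgt.
by apply: eP; rewrite h0.
Qed.

Lemma local_max_derive_eq0 f x c : is_derive x 1 f c ->
  (\forall y \near x, f y <= f x) -> c = 0.
Proof.
move=> df fmax; apply/eqP; rewrite eq_le (local_max_derive_le0 df fmax)/=.
rewrite -oppr_le0; apply: (@local_max_derive_le0 (fun y => f (- y)) (- x)).
  have df' : is_derive (- - x) 1 f c by rewrite opprK.
  have dN : is_derive (- x) 1 (fun y : R => - y) (- 1) by derive.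
  by have := is_derive_fun_comp df' dN; rewrite mulrN1.
rewrite opprK; have : (- y) @[y --> - x] --> x.
  by rewrite -[X in _ --> X]opprK; apply: cvgN; exact: cvg_id.
by move=> /(_ _ fmax).
Qed.

(** Since [f1 x = 0], a positive [c] would make [f1] positive just to the right of [x], and [f]
    would increase there. *)
Lemma local_max_derive2_le0 f (f1 : R -> R) x c :
  (forall y : R, is_derive y 1 f (f1 y)) -> is_derive x 1 f1 c ->
  (\forall y \near x, f y <= f x) -> c <= 0.
Proof.
move=> df df1 fmax; rewrite leNgt; apply/negP => c0.
have f1x : f1 x = 0 := local_max_derive_eq0 (df x) fmax.
have [d d0 dP] := is_derive_gt0_right df1 c0.
have [e e0 eP] := nbhs_right_ball fmax.
pose h := Num.min d e / 2.
have m0 : 0 < Num.min d e by rewrite lt_min d0.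
have h0 : 0 < h by rewrite divr_gt0.
have hm : h < Num.min d e by rewrite ltr_pdivrMr// ltr_pMr// ltr1n.
move: hm; rewrite lt_min => /andP[hd he].
have : f (x + h) <= f x by apply: eP; rewrite h0.
apply/negP; rewrite -ltNge; apply: (@ltr_is_derive _ f f1) => //.
  by rewrite ltrDl.
move=> y /andP[xy yh]; rewrite -f1x -(subrKC x y); apply: dP.
by apply/andP; split; lra.
Qed.

End LocalExtrema.

(** * Monotonicity, growth and homogeneity of [G] *)

Section Nonlinearity.
Variables (R : realType) (sigma : R).
Hypothesis sigma01 : 0 < sigma < 1.
Implicit Types a b c : R.

Let s2 : 0 < sigma ^+ 2 < 1.
Proof. by case/andP: sigma01 => s0 s1; rewrite exprn_gt0//= expr_lt1 ?ltW. Qed.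

Lemma G_mono a b : a <= b -> G sigma a <= G sigma b.
Proof.
move=> ab; have := s2 => /andP[s0 s1]; have [a0|a0] := leP 0 a.
  by rewrite !G_ge0//; lra.
have [b0|b0] := leP 0 b.
  rewrite (G_ge0 _ b0) G_le0 ?(ltW a0)//.
  apply: (@le_trans _ _ 0); last by rewrite divr_ge0.
  by rewrite pmulr_lle0// pmulr_rle0// ltW.
rewrite !G_le0 ?(ltW a0) ?(ltW b0)//.
by rewrite ler_pM2r// ler_pM2l.
Qed.

(** The slopes of [G] are at most [1/2]. Thus adding [e (x^2 + 2 t)] raises the time derivative by
    [2 e] but [G] of the second derivative by at most [e]. *)
Lemma GD_le a e : 0 <= e -> G sigma (a + e) <= G sigma a + e / 2.
Proof.
move=> e0; have := s2 => /andP[s0 s1].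
have [a0|a0] := leP 0 a; first by rewrite !G_ge0 ?addr_ge0//; lra.
rewrite (G_le0 _ (ltW a0)); have [b0|b0] := leP 0 (a + e).
  by rewrite G_ge0//; nra.
by rewrite G_le0 ?(ltW b0)//; nra.
Qed.

Lemma GZ c a : 0 <= c -> G sigma (c * a) = c * G sigma a.
Proof.
move=> c0; have [a0|a0] := leP 0 a.
  by rewrite !G_ge0 ?mulr_ge0// mulrA.
by rewrite !G_le0 ?(ltW a0) ?mulr_ge0_le0 ?(ltW a0)//; field.
Qed.

End Nonlinearity.

Section ProductNeighbourhoods.
Variable R : realType.
Implicit Types (c t x : R).

Lemma near_fst_gt (p : R * R) c : c < p.1 -> \forall q \near p, c < q.1.
Proof.
have cf : q.1 @[q --> p] --> p.1 by exact: cvg_fst.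
by move=> cp; exact: (cvgr_gt _ cf _ cp).
Qed.

Lemma near_continuous (f g : R * R -> R) (p : R * R) :
  (\forall q \near p, f q = g q) ->
  {for p, continuous f} -> {for p, continuous g}.
Proof.
move=> fg cf; rewrite /prop_for /continuous_at -(nbhs_singleton fg).
by apply: cvg_trans cf; apply: near_eq_cvg; apply: filterS fg => q ->.
Qed.

Lemma near_slice_t (Q : R * R -> Prop) t x :
  (\forall p \near (t, x), Q p) -> \forall s \near t, Q (s, x).
Proof.
have ct : s @[s --> t] --> t by exact: cvg_id.
have cx : x @[_ --> t] --> x by exact: cvg_cst.
by move=> /(cvg_pair ct cx).
Qed.

Lemma near_slice_x (Q : R * R -> Prop) t x :
  (\forall p \near (t, x), Q p) -> \forall y \near x, Q (t, y).
Proof.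
have ct : t @[_ --> x] --> t by exact: cvg_cst.
have cx : y @[y --> x] --> x by exact: cvg_id.
by move=> /(cvg_pair ct cx).
Qed.

End ProductNeighbourhoods.

(** * Maximum principle with a quadratic penalty *)

Section MaximumPrinciple.
Variables (R : realType) (w : R -> R -> R) (K : R).
Implicit Types (e t x : R).
Hypothesis cw : {within [set p : R * R | 0 <= p.1],
  continuous (fun p : R * R => w p.1 p.2)}.
Hypothesis wK : forall t x, 0 <= t -> w t x <= K.
Hypothesis w0 : forall x, w 0 x <= 0.

Definition penal (e : R) (p : R * R) : R := w p.1 p.2 - e * (p.2 ^+ 2 + 2 * p.1).

(* The penalty makes the supremum attained on a compact box, and the initial
   condition keeps the maximiser away from [t = 0]. *)
Lemma penal_local_max (e t0 x0 : R) : 0 < e -> 0 <= t0 -> 0 < penal e (t0, x0) ->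
  exists t x : R, 0 < t /\ \forall p \near (t, x), penal e p <= penal e (t, x).
Proof.
move=> e0 t00 pos.
have K0 : 0 <= K.
  have := mulr_ge0 (ltW e0) (addr_ge0 (sqr_ge0 x0) (mulr_ge0 (ler0n R 2) t00)).
  have := wK x0 t00.
  by move: pos; rewrite /penal /=; lra.
have Ke : 0 <= K / e by rewrite divr_ge0// ltW.
have KeE : e * (K / e) = K by rewrite mulrC divfK// gt_eqF.
(* Outside the box with [t >= 0], [x^2 + 2 t >= K / e], so the penalised function is nonpositive;
   the last two terms put [(t0, x0)] inside. *)
pose L := 1 + K / e + t0 + `|x0|.
have x00 := normr_ge0 x0.
have L1 : 1 + K / e <= L by rewrite /L; lra.
pose B : set (R * R) := `[0, L] `*` `[- L, L].
have cB : compact B by apply: compact_setX; exact: segment_compact.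
have B0 : B (t0, x0).
  split; rewrite /= in_itv/=; first by rewrite t00 /L; lra.
  have := ler_norm x0; have := ler_norm (- x0); rewrite normrN /L => ? ?.
  by apply/andP; split; lra.
have B_pos : B `<=` [set p : R * R | 0 <= p.1].
  by move=> p [/= + _]; rewrite in_itv/= => /andP[].
have cp : {within B, continuous (penal e)}.
  move=> p; apply: cvgB; first exact: (continuous_subspaceW B_pos cw).
  suff : {within B, continuous (fun q : R * R => e * (q.2 ^+ 2 + 2 * q.1))} by apply.
  apply: continuous_subspaceT => q; apply: cvgM; first exact: cvg_cst.
  apply: cvgD; last by apply: cvgM; [exact: cvg_cst|exact: cvg_fst].
  by apply: cvgM; exact: cvg_snd.
have [[t x] /set_mem Btx pmax] :=
  compact_EVT_max (ex_intro _ (t0, x0) B0) cB cp.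
have ptx : 0 < penal e (t, x) by rewrite (lt_le_trans pos)// pmax//; exact/mem_set.
have t0' : 0 <= t by exact: B_pos Btx.
have tx_max (p : R * R) : 0 <= p.1 -> penal e p <= penal e (t, x).
  move=> p1; have [pB|pB] := pselect (B p); first by apply: pmax; exact/mem_set.
  apply: (le_trans _ (ltW ptx)); rewrite /penal subr_le0.
  apply: (le_trans (wK p.2 p1)); rewrite -KeE ler_pM2l//.
  have [pL|pL] := leP p.1 L; last by have := sqr_ge0 p.2; lra.
  have [pL2|pL2] := leP `|p.2| L.
    exfalso; apply: pB; split; rewrite /= in_itv/= ?p1//.
    by move: pL2; rewrite ler_norml.
  rewrite -[p.2 ^+ 2]real_normK ?num_real//; nra.
have t_gt0 : 0 < t.
  rewrite lt_neqAle t0' andbT; apply/eqP => t_eq0.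
  move: ptx; rewrite /penal/= -t_eq0 mulr0 addr0.
  have := w0 x; have := mulr_ge0 (ltW e0) (sqr_ge0 x); lra.
exists t, x; split=> //.
by have := @near_fst_gt _ (t, x) 0 t_gt0; apply: filterS => p /ltW/tx_max.
Qed.

Lemma penal_le0 : (forall e t x : R, 0 < e -> 0 < t ->
    ~ \forall p \near (t, x), penal e p <= penal e (t, x)) ->
  forall t x, 0 <= t -> w t x <= 0.
Proof.
move=> no t x t0; rewrite leNgt; apply/negP => wtx.
have S0 : 0 < x ^+ 2 + 2 * t + 1.
  by rewrite ltr_wpDl// addr_ge0 ?sqr_ge0// mulr_ge0.
(* For this value, [penal e (t, x) = e > 0]. *)
pose e := w t x / (x ^+ 2 + 2 * t + 1).
have e0 : 0 < e by rewrite divr_gt0.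
have [|s [y [s0]]] := @penal_local_max e t x e0 t0; last exact: no.
have : e * (x ^+ 2 + 2 * t + 1) = w t x by rewrite divfK// gt_eqF.
by rewrite /penal/=; lra.
Qed.

End MaximumPrinciple.

(** * The self-similar function as the unique bounded viscosity solution *)

Section SelfSimilar.
Variable R : realType.
Variables (sigma l : R) (h h1 h2 : R -> R).
Implicit Types (t x e : R).
Hypotheses (sigma01 : 0 < sigma < 1) (l_gt0 : 0 < l).
Hypotheses (dh : forall y : R, is_derive y 1 h (h1 y))
           (dh1 : forall y : R, is_derive y 1 h1 (h2 y)).
Hypothesis ch2 : continuous h2.
Hypothesis heq : forall x, G sigma (h2 x) = - (x * h1 x / 2 + l * h x).
Variable M : R.
Hypothesis hM : forall x, `|h x| <= M.

Definition selfsim (k : R -> R) (b : R) t x : R :=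
  (1 + t) `^ b * k (x / Num.sqrt (1 + t)).

Local Notation U := (selfsim h (- l)).

(* The derivatives of [U] for [-1 < t]; the value of [U_t] is dictated by the
   equation. *)
Definition U_x t x := selfsim h1 (- l) t x / Num.sqrt (1 + t).
Definition U_xx t x := selfsim h2 (- l) t x / (1 + t).
Definition U_t t x := G sigma (U_xx t x).

Lemma is_derive_U_x t x : 0 < 1 + t -> is_derive x 1 (U t) (U_x t x).
Proof.
move=> t0; rewrite /selfsim; derive; rewrite /U_x /selfsim. ring.
Qed.

Lemma is_derive_U_xx t x : 0 < 1 + t -> is_derive x 1 (U_x t) (U_xx t x).
Proof.
move=> t0; rewrite /U_x /selfsim; derive; rewrite /U_xx /selfsim.
have sE := sqr_sqrtr (ltW t0).
have s0 : Num.sqrt (1 + t) != 0 by rewrite gt_eqF// sqrtr_gt0.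
move: (_ `^ _) => p; move: (Num.sqrt _) sE s0 => s <- s0.
by field.
Qed.

(** The chain rule yields [(1 + t)^(- l - 1)] times the right-hand side of [heq] at
    [x / sqrt (1 + t)]; homogeneity of [G] moves the factor inside. *)
Lemma is_derive_U_t t x : 0 < 1 + t -> is_derive t 1 (U ^~ x) (U_t t x).
Proof.
move=> t0; have s0 : 0 < Num.sqrt (1 + t) by rewrite sqrtr_gt0.
have dD : is_derive t 1 (fun s : R => 1 + s) 1 by derive; ring.
have dp := is_derive_fun_comp (is_derive_fun_powR (- l) t0) dD.
have ds := is_derive_fun_comp (is_derive1_sqrt t0) dD.
have dV := @is_derive_funV _ (fun s : R => Num.sqrt (1 + s)) t _ (lt0r_neq0 s0) ds.
rewrite /selfsim; derive.
rewrite /U_t /U_xx /selfsim [in RHS]mulrAC GZ ?heq; last first.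
  by rewrite divr_ge0 ?powR_ge0// ltW.
rewrite powRB; last by rewrite (gt_eqF t0) implybT.
rewrite powRr1 ?(ltW t0)//.
have sE := sqr_sqrtr (ltW t0); move: (_ `^ _) => p.
move: (Num.sqrt _) sE s0 => s <- s0.
field; rewrite ?gt_eqF//.
Qed.

Let continuous_1D_fst (p : R * R) : {for p, continuous (fun q : R * R => 1 + q.1)}.
Proof. by apply: cvgD; [exact: cvg_cst|exact: cvg_fst]. Qed.

Lemma continuous_selfsim (k : R -> R) b (p : R * R) : continuous k -> 0 < 1 + p.1 ->
  {for p, continuous (fun q : R * R => selfsim k b q.1 q.2)}.
Proof.
move=> ck p0; rewrite /selfsim; apply: cvgM.
  apply: (@continuous_comp _ _ _ (fun q : R * R => 1 + q.1) (fun s => s `^ b)).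
    exact: continuous_1D_fst.
  exact: is_derive_continuous (is_derive_fun_powR b p0).
apply: (@continuous_comp _ _ _ (fun q : R * R => q.2 / Num.sqrt (1 + q.1)) k).
  apply: cvgM; first exact: cvg_snd.
  apply: cvgV; first by rewrite gt_eqF// sqrtr_gt0.
  apply: (@continuous_comp _ _ _ (fun q : R * R => 1 + q.1) Num.sqrt).
    exact: continuous_1D_fst.
  exact: sqrt_continuous.
exact: ck.
Qed.

Lemma continuous_U (p : R * R) : 0 < 1 + p.1 ->
  {for p, continuous (fun q : R * R => U q.1 q.2)}.
Proof.
by apply: continuous_selfsim => x; exact: is_derive_continuous (dh x).
Qed.

Lemma continuous_U_x (p : R * R) : 0 < 1 + p.1 ->
  {for p, continuous (fun q : R * R => U_x q.1 q.2)}.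
Proof.
move=> p0; apply: cvgM.
  by apply: continuous_selfsim => // x; exact: is_derive_continuous (dh1 x).
apply: cvgV; first by rewrite gt_eqF// sqrtr_gt0.
apply: (@continuous_comp _ _ _ (fun q : R * R => 1 + q.1) Num.sqrt).
  exact: continuous_1D_fst.
exact: sqrt_continuous.
Qed.

Lemma continuous_U_xx (p : R * R) : 0 < 1 + p.1 ->
  {for p, continuous (fun q : R * R => U_xx q.1 q.2)}.
Proof.
move=> p0; apply: cvgM; first exact: continuous_selfsim.
by apply: cvgV; [rewrite gt_eqF|exact: continuous_1D_fst].
Qed.

Lemma continuous_G : continuous (G sigma).
Proof.
move=> x; rewrite /G /neg_part /pos_part.
apply: cvgM; first exact: cvg_cst.
apply: cvgB.
  by apply: continuous_max; [exact: cvg_cst|exact: cvg_id].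
apply: cvgM; first exact: cvg_cst.
by apply: continuous_max; [exact: cvg_cst|apply: cvgN; exact: cvg_id].
Qed.

Lemma continuous_U_t (p : R * R) : 0 < 1 + p.1 ->
  {for p, continuous (fun q : R * R => U_t q.1 q.2)}.
Proof.
move=> p0.
apply: (@continuous_comp _ _ _ (fun q : R * R => U_xx q.1 q.2) (G sigma)).
  exact: continuous_U_xx.
exact: continuous_G.
Qed.

(** At positive times a strict supersolution for [e > 0] and a strict subsolution for [e < 0], by
    [GD_le]. *)
Definition U_pert e t x := U t x + e * (x ^+ 2 + 2 * t).

Lemma is_derive_U_pert_t e t x : 0 < 1 + t ->
  is_derive t 1 (U_pert e ^~ x) (U_t t x + 2 * e).
Proof.
move=> t0; have d := is_derive_U_t x t0.
by rewrite /U_pert; derive; ring.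
Qed.

Lemma is_derive_U_pert_x e t x : 0 < 1 + t ->
  is_derive x 1 (U_pert e t) (U_x t x + 2 * e * x).
Proof.
move=> t0; have d := is_derive_U_x x t0.
by rewrite /U_pert; derive; ring.
Qed.

Lemma d_t_U_pert e t x : 0 < 1 + t -> d_t (U_pert e) t x = U_t t x + 2 * e.
Proof. by move=> t0; exact: is_derive_derive1 (is_derive_U_pert_t e x t0). Qed.

Lemma d_x_U_pert e t : 0 < 1 + t ->
  d_x (U_pert e) t = (fun x => U_x t x + 2 * e * x).
Proof.
by move=> t0; apply/funext => x; exact: is_derive_derive1 (is_derive_U_pert_x e x t0).
Qed.

Lemma is_derive_d_x_U_pert e t x : 0 < 1 + t ->
  is_derive x 1 (d_x (U_pert e) t) (U_xx t x + 2 * e).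
Proof.
move=> t0; have d := is_derive_U_xx x t0.
by rewrite d_x_U_pert//; derive; ring.
Qed.

Lemma d_xx_U_pert e t x : 0 < 1 + t -> d_xx (U_pert e) t x = U_xx t x + 2 * e.
Proof. by move=> t0; exact: is_derive_derive1 (is_derive_d_x_U_pert e x t0). Qed.

Lemma C12_U_pert e : C12 (U_pert e).
Proof.
move=> t x t0; have t1 : 0 < 1 + t by rewrite addr_gt0.
have near1 : \forall q \near (t, x), 0 < 1 + q.1.
  have := @near_fst_gt _ (t, x) 0 t0; apply: filterS => q q0.
  by rewrite addr_gt0.
split.
- by case: (is_derive_U_pert_t e x t1).
- by case: (is_derive_U_pert_x e x t1).
- by case: (is_derive_d_x_U_pert e x t1).
split.
- apply: cvgD; first exact: continuous_U.
  apply: cvgM; first exact: cvg_cst.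
  apply: cvgD; last by apply: cvgM; [exact: cvg_cst|exact: cvg_fst].
  by apply: cvgM; exact: cvg_snd.
- apply: (@near_continuous _ (fun p => U_t p.1 p.2 + 2 * e)).
    by apply: filterS near1 => q q0; rewrite d_t_U_pert.
  by apply: cvgD; [exact: continuous_U_t|exact: cvg_cst].
- apply: (@near_continuous _ (fun p => U_x p.1 p.2 + 2 * e * p.2)).
    by apply: filterS near1 => q q0; rewrite d_x_U_pert.
  apply: cvgD; first exact: continuous_U_x.
  by apply: cvgM; [exact: cvg_cst|exact: cvg_snd].
- apply: (@near_continuous _ (fun p => U_xx p.1 p.2 + 2 * e)).
    by apply: filterS near1 => q q0; rewrite d_xx_U_pert.
  by apply: cvgD; [exact: continuous_U_xx|exact: cvg_cst].
Qed.

Lemma C12_derive psi t x : C12 psi -> 0 < t ->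
  [/\ is_derive t 1 (psi ^~ x) (d_t psi t x),
      forall y : R, is_derive y 1 (psi t) (d_x psi t y) &
      forall y : R, is_derive y 1 (d_x psi t) (d_xx psi t y)].
Proof.
move=> Cpsi t0; split.
- have [d _ _ _] := Cpsi t x t0.
  by rewrite /d_t derive1E; apply: DeriveDef.
- move=> y; have [_ d _ _] := Cpsi t y t0.
  by rewrite /d_x derive1E; apply: DeriveDef.
- move=> y; have [_ _ d _] := Cpsi t y t0.
  by split; [exact: d|rewrite -derive1E; reflexivity].
Qed.

(** Along the two slices, a maximum of [U - psi] gives [d_t psi = U_t] and [U_xx <= d_xx psi]; then
    [G] is monotone. *)
Lemma U_subsolution : viscosity_subsolution sigma U.
Proof.
move=> psi Cpsi t x t0 umax; have t1 : 0 < 1 + t by rewrite addr_gt0.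
have [dt dx dxx] := C12_derive x Cpsi t0.
have e_t : U_t t x - d_t psi t x = 0.
  apply: (@local_max_derive_eq0 _ (fun s => U s x - psi s x) t).
    by have d := is_derive_U_t x t1; derive.
  exact: near_slice_t umax.
have e_xx : U_xx t x - d_xx psi t x <= 0.
  apply: (@local_max_derive2_le0 _ (fun y => U t y - psi t y)
    (fun y => U_x t y - d_x psi t y) x).
  - by move=> y; have d := is_derive_U_x y t1; derive.
  - by have d := is_derive_U_xx x t1; derive.
  - exact: near_slice_x umax.
have -> : d_t psi t x = U_t t x by lra.
by rewrite subr_le0 G_mono//; lra.
Qed.

Lemma U_supersolution : viscosity_supersolution sigma U.
Proof.
move=> psi Cpsi t x t0 umin; have t1 : 0 < 1 + t by rewrite addr_gt0.
have [dt dx dxx] := C12_derive x Cpsi t0.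
have umax : \forall p \near (t, x), psi p.1 p.2 - U p.1 p.2 <= psi t x - U t x.
  by apply: filterS umin => p; lra.
have e_t : d_t psi t x - U_t t x = 0.
  apply: (@local_max_derive_eq0 _ (fun s => psi s x - U s x) t).
    by have d := is_derive_U_t x t1; derive.
  exact: near_slice_t umax.
have e_xx : d_xx psi t x - U_xx t x <= 0.
  apply: (@local_max_derive2_le0 _ (fun y => psi t y - U t y)
    (fun y => d_x psi t y - U_x t y) x).
  - by move=> y; have d := is_derive_U_x y t1; derive.
  - by have d := is_derive_U_xx x t1; derive.
  - exact: near_slice_x umax.
have -> : d_t psi t x = U_t t x by lra.
by rewrite subr_ge0 G_mono//; lra.
Qed.

Lemma U_bounded : bounded_for_nonneg_times U.
Proof.
exists M => t x t0; have t1 : 1 <= 1 + t by rewrite lerDl.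
rewrite normrM ger0_norm ?powR_ge0//.
rewrite (le_trans _ (hM (x / Num.sqrt (1 + t))))// ler_piMl//.
by rewrite -[leRHS](powRr0 (1 + t)) ler_powR// oppr_le0 ltW.
Qed.

Lemma U0 x : U 0 x = h x.
Proof. by rewrite /selfsim addr0 powR1 mul1r sqrtr1 divr1. Qed.

Lemma U_within_continuous :
  {within [set p : R * R | 0 <= p.1], continuous (fun p : R * R => U p.1 p.2)}.
Proof.
apply: continuous_in_subspaceT => p /set_mem/= p0; apply: continuous_U.
by rewrite ltr_wpDr.
Qed.

Lemma U_solution : G_heat_solution sigma h U.
Proof.
split; [exact: U_within_continuous|exact: U_subsolution|exact: U_supersolution|].
exact: U0.
Qed.

(** A penalised maximum of [v - U] lets [U_pert e] touch [v] from above, against the subsolution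
    test; one of [U - v] lets [U_pert (- e)] touch [v] from below, against the supersolution
    test. *)
Lemma U_unique v : bounded_for_nonneg_times v -> G_heat_solution sigma h v ->
  forall t x, 0 <= t -> v t x = U t x.
Proof.
move=> [Mv vM] [cv vsub vsuper v0] t x t0; have [MU UM] := U_bounded.
apply/eqP; rewrite eq_le -subr_le0 -[leRHS in _ && leRHS]subr_le0.
apply/andP; split.
- apply: (@penal_le0 _ (fun t x => v t x - U t x) (Mv + MU)) => //.
  + by move=> p; apply: cvgB; [exact: cv|exact: U_within_continuous].
  + move=> s y s0; have := vM s y s0; have := UM s y s0.
    by rewrite !ler_norml => /andP[? ?] /andP[? ?]; lra.
  + by move=> y; rewrite v0 U0 subrr.
  move=> e s y e0 s0 vmax; have s1 : 0 < 1 + s by rewrite addr_gt0.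
  have := vsub _ (C12_U_pert e) s y s0.
  rewrite d_t_U_pert// d_xx_U_pert//.
  have e2 : 0 <= 2 * e by rewrite mulr_ge0// ltW.
  have := GD_le sigma01 (U_xx s y) e2; rewrite -/(U_t s y) => hG hv.
  suff /hv : \forall p \near (s, y),
      v p.1 p.2 - U_pert e p.1 p.2 <= v s y - U_pert e s y by lra.
  by apply: filterS vmax => p; rewrite /penal /U_pert /=; lra.
- apply: (@penal_le0 _ (fun t x => U t x - v t x) (Mv + MU)) => //.
  + by move=> p; apply: cvgB; [exact: U_within_continuous|exact: cv].
  + move=> s y s0; have := vM s y s0; have := UM s y s0.
    by rewrite !ler_norml => /andP[? ?] /andP[? ?]; lra.
  + by move=> y; rewrite v0 U0 subrr.
  move=> e s y e0 s0 vmax; have s1 : 0 < 1 + s by rewrite addr_gt0.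
  have := vsuper _ (C12_U_pert (- e)) s y s0.
  rewrite d_t_U_pert// d_xx_U_pert//.
  have e2 : 0 <= 2 * e by rewrite mulr_ge0// ltW.
  have := GD_le sigma01 (U_xx s y + 2 * - e) e2.
  rewrite (_ : U_xx s y + 2 * - e + 2 * e = U_xx s y); last by ring.
  rewrite -/(U_t s y) => hG hv.
  suff /hv : \forall p \near (s, y),
      v s y - U_pert (- e) s y <= v p.1 p.2 - U_pert (- e) p.1 p.2 by lra.
  by apply: filterS vmax => p; rewrite /penal /U_pert /=; lra.
Qed.

End SelfSimilar.

(** * Identification of [H] with the glued profile, and conclusion *)

Lemma H_profileH (R : realType) (lam sigma : R) : 0 < lam < 2^-1 ->
  H lam sigma = profileH lam sigma (z lam) (phi lam) (moment (1 - 2 * lam)).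
Proof.
move=> l01; apply/funext => x.
have c1E : mu1 lam sigma =
    outer_coef1 lam sigma (z lam) (phi lam) (moment (1 - 2 * lam)).
  by rewrite /mu1 !phi''E.
have c2E : mu2 lam sigma =
    outer_coef2 lam sigma (z lam) (phi lam) (moment (1 - 2 * lam)).
  by rewrite /mu2 !phi''E.
rewrite /H /profileH /piecewise /outer0 /even0 c1E c2E opprK.
case: ifP => _; first by rewrite [LHS]addrC.
by case: ifP.
Qed.

Theorem theorem3p16 (R : realType) (sigma : R) (hsigma : 0 < sigma < 1)
    (lam : R) (hlam : 0 < lam <= lambda_ sigma) :
  (forall t x : R, 0 <= t -> 0 < uH lam sigma t x) /\
  (bounded_for_nonneg_times (uH lam sigma) /\
   G_heat_solution sigma (H lam sigma) (uH lam sigma) /\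
   (forall v : R -> R -> R,
      bounded_for_nonneg_times v ->
      G_heat_solution sigma (H lam sigma) v ->
      forall t x : R, 0 <= t -> v t x = uH lam sigma t x)).
Proof.
have [l01 f2a] := prof2_opp_sigma_z_ge0 hsigma hlam.
have P := phi_profile l01; have [z0 e2z] := zP l01.
have l0 : 0 < lam by case/andP: l01.
have HE := H_profileH sigma l01.
have H0 := profileH_gt0 P hsigma z0 e2z f2a.
have dH := is_derive_profileH P hsigma z0 e2z f2a.
have dH1 := is_derive_profileH1 P hsigma z0 e2z f2a.
have cH2 := continuous_profileH2 P hsigma z0 e2z f2a.
have eqH := profileH_eq P hsigma z0 e2z f2a.
have [M HM] := profileH_bounded P hsigma z0 e2z f2a.
rewrite -HE in H0 dH dH1 HM; rewrite -?HE in eqH.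
(* From here on only the sign, bound, derivatives and equation of the profile matter, so its
   piecewise form is generalised away. *)
move: (profileH1 _ _ _ _ _) (profileH2 _ _ _ _ _) dH dH1 cH2 eqH.
have -> : uH lam sigma = selfsim (H lam sigma) (- lam) by [].
move: (H lam sigma) H0 HM => h h0 hM h1 h2 dh dh1 ch2 heq.
have {}hM x : `|h x| <= M by rewrite ger0_norm// ltW.
split=> [t x t0|].
  by rewrite mulr_gt0 ?powR_gt0// ltr_wpDr.
split; first exact: (U_bounded l0 hM).
split; first exact: (U_solution hsigma dh dh1 heq).
exact: (U_unique hsigma l0 dh dh1 ch2 heq hM).
Qed.
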